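(* Let $\alpha\ge0$ and let $C_1$ and $C_2$ be two curves that are both closed connected subsets of $\mathcal H_\alpha$. Let $T_1$ and $T_2$ be their respective enveloping triangles. (i) If $\mathsf A(T_1)=\mathsf A(T_2)$ then $\mathsf L(C_1)=\mathsf L(C_2)$ and $\mathsf A(\mathsf{CH}(C_1))=\mathsf A(\mathsf{CH}(C_2))$. (ii) If $\mathsf L(C_1)=\mathsf L(C_2)$ then $\mathsf A(\mathsf{CH}(C_1))=\mathsf A(\mathsf{CH}(C_2))$ and $\mathsf A(T_1)=\mathsf A(T_2)$. (iii) If $\mathsf A(\mathsf{CH}(C_1))=\mathsf A(\mathsf{CH}(C_2))$ then $\mathsf L(C_1)=\mathsf L(C_2)$ and $\mathsf A(T_1)=\mathsf A(T_2)$. (iv) Each of the following pairs characterizes $\alpha$: (a) $(\mathsf A(T_1),\mathsf A(\mathsf{CH}(C_1)))$; (b) $(\mathsf A(T_1),\mathsf L(C_1))$; (c) $(\mathsf A(\mathsf{CH}(C_1)),\mathsf L(C_1))$. (That is: if $C_1\subset\mathcal H_\alpha$ and $C_1'\subset\mathcal H_{\alpha'}$ are two such curves, with $\alpha,\alpha'\ge0$, for which one of these pairs takes the same value, then $\alpha=\alpha'$.)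
   Context: $\mathsf{CH}$ denotes the convex hull, $\mathsf A$ the area, and $\mathsf L(\mathcal C)=\int_{\mathcal C}\kappa(s)^{1/3}ds$ the affine length of a curve ($\kappa\ge 0$ curvature, $s$ Euclidean arc length). The map $\Psi(r)=\frac{\sinh(2r)}{2r}-1$ (with $\Psi(0)=0$) is a continuous increasing bijection of $[0,+\infty)$ onto itself; $r_\lambda:=\Psi^{-1}(\lambda)$. For $\lambda>0$, $\mathcal H_\lambda=\{(X(t),Y(t)):t\in[0,1]\}$ with $$X(t)=1+\frac{\sinh(r_\lambda(1-2t))}{\sinh(r_\lambda)},\qquad Y(t)=\frac{2\cosh(r_\lambda)}{\sinh(r_\lambda)^2}\sinh(r_\lambda(1-t))\sinh(r_\lambda t),$$ and $\mathcal H_0$ is the parabola $\{(x,x(2-x)/2):0\le x\le2\}$. A simple closed connected curve here means a set $C=\gamma([0,1])$ with $\gamma:[0,1]\to\mathbb R^2$ continuous and injective; $\gamma(0),\gamma(1)$ are its extremities. A triangle $T=abc$ is the enveloping triangle of such a $C$ if: $\{a,b\}$ is the set of extremities of $C$; $C\subset T$; and $T$ is the intersection of all triangles having these first two properties (i.e. all triangles that contain $C$ and have the two extremities of $C$ among their vertices). *)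

(* Defs.v *)
From HB Require Import structures.
From mathcomp Require Import all_boot all_order all_algebra.
From mathcomp Require Import all_classical all_reals all_analysis.
Set Implicit Arguments.
Unset Strict Implicit.
Unset Printing Implicit Defensive.
Import Order.TTheory GRing.Theory Num.Theory.
Import numFieldNormedType.Exports.
Local Open Scope classical_set_scope.
Local Open Scope ring_scope.

Definition sinh {R : realType} (x : R) : R := (expR x - expR (- x)) / 2.
Definition cosh {R : realType} (x : R) : R := (expR x + expR (- x)) / 2.

Definition Psi {R : realType} (r : R) : R :=
  if r == 0 then 0 else sinh (2 * r) / (2 * r) - 1.

(* The inverse of the bijection Psi of [0, +oo[; the default value 0 is only
   reached for lam < 0. *)
Definition rpar {R : realType} (lam : R) : R :=
  xget 0 [set r : R | 0 <= r /\ Psi r = lam].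

Definition hyperX {R : realType} (lam t : R) : R :=
  let r := rpar lam in 1 + sinh (r * (1 - 2 * t)) / sinh r.

Definition hyperY {R : realType} (lam t : R) : R :=
  let r := rpar lam in
  2 * cosh r / sinh r ^+ 2 * sinh (r * (1 - t)) * sinh (r * t).

Definition Hcurve {R : realType} (lam : R) : set (R * R) :=
  if lam == 0 then [set (x, x * (2 - x) / 2) | x in `[0, 2]]
  else [set (hyperX lam t, hyperY lam t) | t in `[0, 1]].

Definition convex_hull {R : realType} (A : set (R^o * R^o)) : set (R^o * R^o) :=
  smallest (@convex_set R (R^o * R^o)%type) A.

Definition area {R : realType} (A : set (R * R)) : \bar R :=
  (lebesgue_measure \x lebesgue_measure)%E A.

Definition simple_param {R : realType} (g : R -> R * R) (C : set (R * R)) :=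
  [/\ {within `[0, 1], continuous g}, {in `[0, 1] &, injective g} &
      g @` `[0, 1] = C].

Definition simple_curve {R : realType} (C : set (R * R)) :=
  exists g : R -> R * R, simple_param g C.

Definition extremities {R : realType} (C : set (R * R)) (a b : R * R) :=
  exists g : R -> R * R, [/\ simple_param g C, g 0 = a & g 1 = b].

Definition collinear {R : realType} (a b c : R * R) :=
  (b.1 - a.1) * (c.2 - a.2) = (b.2 - a.2) * (c.1 - a.1).

Definition triangle {R : realType} (a b c : R * R) : set (R * R) :=
  convex_hull [set a; b; c].

Definition covering_triangle {R : realType} (C T : set (R * R)) :=
  exists a b c : R * R,
    [/\ ~ collinear a b c, T = triangle a b c, extremities C a b & C `<=` T].

Definition enveloping_triangle {R : realType} (C T : set (R * R)) :=
  covering_triangle C T /\ T = \bigcap_(T' in covering_triangle C) T'.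

(* A C^2 curve on `[0, 1] is taken as the restriction of a C^2 map on R, so that
   no one-sided derivatives are needed; any C^2 map on `[0, 1] extends so. *)
Definition regular_param {R : realType} (g : R -> R * R) (C : set (R * R)) :=
  let x : R -> R := fst \o g in
  let y : R -> R := snd \o g in
  [/\ simple_param g C,
      forall t : R, derivable x t 1 /\ derivable y t 1,
      forall t : R, derivable (derive1 x) t 1 /\ derivable (derive1 y) t 1,
      continuous (derive1n 2 x) /\ continuous (derive1n 2 y) &
      forall t : R, t \in `[0, 1] -> (derive1 x t, derive1 y t) != (0, 0)].

Definition speed {R : realType} (g : R -> R * R) (t : R) : R :=
  Num.sqrt (derive1 (fst \o g) t ^+ 2 + derive1 (snd \o g) t ^+ 2).

Definition curvature {R : realType} (g : R -> R * R) (t : R) : R :=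
  `|derive1 (fst \o g) t * derive1n 2 (snd \o g) t
    - derive1 (snd \o g) t * derive1n 2 (fst \o g) t| / speed g t ^+ 3.

(* The integral of kappa^(1/3) ds with ds = speed g t dt; it does not depend on
   the regular parametrization g of C, and 0 is a dummy value for the sets
   having none. *)
Definition affine_length {R : realType} (C : set (R * R)) : R :=
  xget 0 [set l : R | exists2 g : R -> R * R, regular_param g C &
    l = \int[lebesgue_measure]_(t in `[0, 1])
          (curvature g t `^ 3^-1 * speed g t)].

(* Main.v *)
Require Import Defs.
From HB Require Import structures.
From mathcomp Require Import all_boot all_order all_algebra.
From mathcomp Require Import ring lra.
From mathcomp Require Import all_classical all_reals all_analysis.
From mathcomp Require Import measurable_realfun.
Import Order.TTheory GRing.Theory Num.Theory.
Import numFieldNormedType.Exports.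
Set Implicit Arguments.
Unset Strict Implicit.
Unset Printing Implicit Defensive.
Local Open Scope classical_set_scope.
Local Open Scope ring_scope.

(** The proof treats the parabola and the hyperbolas by one family of functions.
For k >= 0 let sn, cs, vs, ms be sinh(ku)/k, cosh(ku), (cosh(ku)-1)/k^2 and
(sinh(ku)/k-u)/k^2, with the values u, 1, u^2/2, u^3/6 when k = 0. Up to an
affine map of Jacobian J(k) = cs k 1 / sn k 1 ^ 3, each H_alpha is the arc
u |-> (sn k u, vs k u), -1 <= u <= 1, of a conic, where
k = r_alpha, and k = 0 for the parabola ([Hcurve_harc]). The parameter u is the
affine arc length of that conic, and translations in u act on it by unimodular
affine maps. So a subarc C, which is the image of some interval [p, q]
([param_arc]), has its three invariants determined by k and d = q - p alone:
A(T) = J(k) vs(d)^2 / (2 sn(d)), A(CH(C)) = J(k) ms(d) / 2 and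
L(C) = J(k)^(1/3) d ([curve_invariants]).

The three formulas are obtained as follows. The intersection of all covering
triangles is the triangle cut by the two extreme tangents: this triangle covers
the arc by convexity, and a triangle that covers the arc and has its ends as
vertices must contain the tangent directions at both ends, hence the point where
the two tangents meet ([enveloping_triangleE]). The convex hull is the region
between the chord and the arc ([convex_hull_arc]), whose area is an integral.
For the affine length, any regular parametrization is the composition of
u |-> (X(u), Y(u)) with a monotone function phi, its second order determinant is
-J phi'^3, and the integrand is thus J^(1/3) |phi'|
([regular_param_affine_length]).

By homogeneity A(T) = J d^3 t(kd), A(CH(C)) = J d^3 h(kd) and L^3 = J d^3, for
two functions t and h of one variable x >= 0. Both are positive and increasing,
so on a fixed curve H each invariant is an increasing function of d, and thus
determines d and the two others. As for alpha, the ratios of A(T), A(CH(C)) and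
L^3 are t(x), h(x) and h(x)/t(x), all strictly increasing in x >= 0
([tshape_incr], [hshape_incr], [htshape_incr]); so two invariants determine
x = kd, then J(k) d^3, hence J(k)/k^3 = cosh k / sinh^3 k, which determines k
([jac_inj]), and alpha = Psi(k). *)

(** * Hyperbolic functions *)

Section hyperbolic.
Context {R : realType}.
Implicit Types x y : R.

Lemma sinh0 : sinh 0 = 0 :> R.
Proof. by rewrite /sinh oppr0 subrr mul0r. Qed.

Lemma cosh0 : cosh 0 = 1 :> R.
Proof. by rewrite /cosh oppr0 expR0 divff. Qed.

Lemma sinhN x : sinh (- x) = - sinh x.
Proof. by rewrite /sinh opprK; field. Qed.

Lemma coshN x : cosh (- x) = cosh x.
Proof. by rewrite /cosh opprK addrC. Qed.

Lemma sinhD x y : sinh (x + y) = sinh x * cosh y + cosh x * sinh y.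
Proof. by rewrite /sinh /cosh opprD !expRD; field. Qed.

Lemma coshD x y : cosh (x + y) = cosh x * cosh y + sinh x * sinh y.
Proof. by rewrite /sinh /cosh opprD !expRD; field. Qed.

Lemma cosh_sq x : cosh x ^+ 2 = 1 + sinh x ^+ 2.
Proof.
transitivity (expR x * expR (- x) + sinh x ^+ 2); last by rewrite expRxMexpNx_1.
by rewrite /cosh /sinh; field.
Qed.

Lemma cosh_gt0 x : 0 < cosh x.
Proof. by rewrite divr_gt0// addr_gt0 ?expR_gt0. Qed.

Lemma is_derive_sinh x : is_derive x 1 (@sinh R) (cosh x).
Proof.
by rewrite /sinh /cosh; apply: is_derive_eq; rewrite /GRing.scale/=; field.
Qed.

Lemma is_derive_cosh x : is_derive x 1 (@cosh R) (sinh x).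
Proof.
by rewrite /sinh /cosh; apply: is_derive_eq; rewrite /GRing.scale/=; field.
Qed.
End hyperbolic.

(** * Sines of a conic with parameter k *)

Section generalized.
Context {R : realType}.
Implicit Types k u : R.

(** Solutions of sn' = cs, cs' = k^2 sn, vs' = sn, ms' = vs that vanish at 0,
except cs which is 1 there; the case k = 0 is the limit, and makes the parabola
an instance of the same formulas. *)
Definition sn k u := if k == 0 then u else sinh (k * u) / k.
Definition cs k u := cosh (k * u).
Definition vs k u := if k == 0 then u ^+ 2 / 2 else (cosh (k * u) - 1) / k ^+ 2.
Definition ms k u :=
  if k == 0 then u ^+ 3 / 6 else (sinh (k * u) / k - u) / k ^+ 2.

Lemma sn0 k : sn k 0 = 0.
Proof. by rewrite /sn mulr0 sinh0 mul0r if_same. Qed.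

Lemma cs0 k : cs k 0 = 1.
Proof. by rewrite /cs mulr0 cosh0. Qed.

Lemma vs0 k : vs k 0 = 0.
Proof. by rewrite /vs mulr0 cosh0 subrr !expr0n !mul0r if_same. Qed.

Lemma ms0 k : ms k 0 = 0.
Proof. by rewrite /ms mulr0 sinh0 !expr0n !mul0r subrr mul0r if_same. Qed.

Lemma snN k u : sn k (- u) = - sn k u.
Proof. by rewrite /sn mulrN sinhN mulNr; case: ifP. Qed.

Lemma vsN k u : vs k (- u) = vs k u.
Proof. by rewrite /vs mulrN coshN sqrrN. Qed.

Lemma cs_gt0 k u : 0 < cs k u.
Proof. exact: cosh_gt0. Qed.

Lemma csE k u : cs k u = 1 + k ^+ 2 * vs k u.
Proof.
rewrite /cs /vs; case: eqP => [->|/eqP k0].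
  by rewrite mul0r cosh0 expr0n mul0r addr0.
by field.
Qed.

Lemma sn_sq k u : sn k u ^+ 2 = vs k u * (1 + cs k u).
Proof.
rewrite /sn /cs /vs; case: eqP => [->|/eqP k0].
  by rewrite mul0r cosh0; field.
transitivity ((cosh (k * u) ^+ 2 - 1) / k ^+ 2); last by field.
by rewrite cosh_sq; field.
Qed.

(** With [vsD], an exact second order Taylor formula for the curve (sn, vs):
the increment from p to p + e is sn(e) times the first derivative at p plus
vs(e) times the second one. *)
Lemma snD k p e : sn k (p + e) = sn k p + (cs k p * sn k e + k ^+ 2 * sn k p * vs k e).
Proof.
rewrite /sn /vs /cs; case: eqP => [->|/eqP k0].
  by rewrite mul0r cosh0 expr0n /= !mul0r addr0 mul1r.
by rewrite mulrDr sinhD; field.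
Qed.

Lemma vsD k p e : vs k (p + e) = vs k p + (sn k p * sn k e + cs k p * vs k e).
Proof.
rewrite /sn /vs /cs; case: eqP => [->|/eqP k0].
  by rewrite mul0r cosh0 mul1r; field.
by rewrite mulrDr coshD; field.
Qed.

(** Invariance of the area of a segment of the conic under u |-> u - p. *)
Lemma msB k p q :
  ms k (q - p) = ms k q - ms k p + (sn k q * vs k p - sn k p * vs k q).
Proof.
rewrite /ms /sn /vs; case: eqP => [_|/eqP k0]; first by field.
by rewrite mulrBr sinhD sinhN coshN; field.
Qed.

Lemma is_derive_sn k u : is_derive u 1 (sn k) (cs k u).
Proof.
rewrite /cs; have [->|k0] := eqVneq k 0.
  rewrite mul0r cosh0 (_ : sn 0 = id); first exact: is_derive_id.
  by apply/funext => x; rewrite /sn eqxx.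
rewrite (_ : sn k = fun u => k^-1 * sinh (k * u)).
  have ? := is_derive_sinh (k * u).
  by apply: is_derive_eq; rewrite /GRing.scale/=; field.
by apply/funext => x; rewrite /sn (negbTE k0) mulrC.
Qed.

Lemma is_derive_vs k u : is_derive u 1 (vs k) (sn k u).
Proof.
rewrite /sn; have [->|k0] := eqVneq k 0.
  rewrite (_ : vs 0 = fun u => 2^-1 * u ^+ 2).
    by apply: is_derive_eq; rewrite /GRing.scale/=; field.
  by apply/funext => x; rewrite /vs eqxx mulrC.
rewrite (_ : vs k = fun u => (k ^+ 2)^-1 * (cosh (k * u) - 1)).
  have ? := is_derive_cosh (k * u).
  by apply: is_derive_eq; rewrite /GRing.scale/=; field.
by apply/funext => x; rewrite /vs (negbTE k0) mulrC.
Qed.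

Lemma is_derive_ms k u : is_derive u 1 (ms k) (vs k u).
Proof.
have [->|k0] := eqVneq k 0.
  rewrite (_ : ms 0 = fun u => 6^-1 * u ^+ 3).
    by apply: is_derive_eq; rewrite /vs eqxx /GRing.scale/=; field.
  by apply/funext => x; rewrite /ms eqxx mulrC.
rewrite (_ : ms k = fun u => (k ^+ 2)^-1 * (sn k u - u)).
  have ? := is_derive_sn k u.
  by apply: is_derive_eq; rewrite /vs /cs (negbTE k0) /GRing.scale/=; field.
by apply/funext => x; rewrite /ms /sn (negbTE k0) mulrC.
Qed.

Lemma is_derive_cs k u : is_derive u 1 (cs k) (k ^+ 2 * sn k u).
Proof.
have ? := is_derive_vs k u.
rewrite (_ : cs k = fun u => 1 + k ^+ 2 * vs k u).
  by apply: is_derive_eq; rewrite /GRing.scale/=; field.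
by apply/funext => x; exact: csE.
Qed.

Lemma sn_double k u : sn k (u + u) = 2 * sn k u * cs k u.
Proof.
have h : k ^+ 2 * vs k u = cs k u - 1 by rewrite csE; ring.
by rewrite snD; ring: h.
Qed.

Lemma vs_double k u : vs k (u + u) = 2 * sn k u ^+ 2.
Proof. by rewrite vsD; have := sn_sq k u => h; ring: h. Qed.

End generalized.

(** * Monotonicity from derivatives *)

Section increasing.
Context {R : realType}.
Implicit Types (f g df dg : R -> R) (x : R).

Lemma derive_incr f df (a : R) :
  (forall x, a <= x -> is_derive x 1 f (df x)) ->
  (forall x, a < x -> 0 < df x) ->
  forall x y, a <= x -> x < y -> f x < f y.
Proof.
move=> fdf df0 x y ax xy.
apply: (@gtr0_derive1_lt_cc _ f x y); rewrite ?bound_itvE ?(ltW xy)//.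
- by move=> z /[!in_itv]/= /andP[xz _]; have [] := fdf z (le_trans ax (ltW xz)).
- move=> z /[!in_itv]/= /andP[xz _].
  rewrite derive1E; have := fdf z (le_trans ax (ltW xz)).
  by move=> /(@derive_val _ _ _ _ _ _ _) ->; apply/df0/(le_lt_trans ax).
- apply: derivable_within_continuous => z /[!in_itv]/= /andP[xz _].
  by have [] := fdf z (le_trans ax xz).
Qed.

Lemma derive_pos f df :
  (forall x, is_derive x 1 f (df x)) -> f 0 = 0 ->
  (forall x, 0 < x -> 0 < df x) -> forall x, 0 < x -> 0 < f x.
Proof.
move=> fdf f0 df0 x x0; rewrite -f0.
exact: (@derive_incr f df 0).
Qed.

(** Stated with the numerator of the derivative of the quotient, which is the
form in which the signs are found below. *)
Lemma ratio_incr f g df dg (a : R) :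
  (forall x, is_derive x 1 f (df x)) -> (forall x, is_derive x 1 g (dg x)) ->
  (forall x, a < x -> 0 < g x) ->
  (forall x, a < x -> 0 < df x * g x - f x * dg x) ->
  forall x y, a < x -> x < y -> f x / g x < f y / g y.
Proof.
move=> fdf gdg g0 w0 x y ax xy.
apply: (@derive_incr (fun z => f z * (g z)^-1)
  (fun z => (df z * g z - f z * dg z) / g z ^+ 2) x) => // z xz.
  have gz : g z != 0 by rewrite gt_eqF// g0// (lt_le_trans ax).
  have ? := fdf z; have ? := gdg z; have ? := is_deriveV gz (gdg z).
  by apply: is_derive_eq; rewrite /GRing.scale/=; field.
by rewrite divr_gt0 ?exprn_gt0 ?w0 ?g0// (lt_trans ax).
Qed.

End increasing.

Section positivity.
Context {R : realType}.
Implicit Types k u x : R.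

Lemma sn_gt0 k u : 0 < u -> 0 < sn k u.
Proof.
apply: (@derive_pos _ (sn k) (cs k)); first exact: is_derive_sn.
  exact: sn0.
by move=> x _; exact: cs_gt0.
Qed.

Lemma vs_gt0 k u : 0 < u -> 0 < vs k u.
Proof.
apply: (@derive_pos _ (vs k) (sn k)); first exact: is_derive_vs.
  exact: vs0.
by move=> x; exact: sn_gt0.
Qed.

Lemma ms_gt0 k u : 0 < u -> 0 < ms k u.
Proof.
apply: (@derive_pos _ (ms k) (vs k)); first exact: is_derive_ms.
  exact: ms0.
by move=> x; exact: vs_gt0.
Qed.

Lemma sn_incr k p q : p < q -> sn k p < sn k q.
Proof.
apply: (@derive_incr _ (sn k) (cs k) p) => // x _; first exact: is_derive_sn.
exact: cs_gt0.
Qed.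

Lemma cosh_incr x y : 0 <= x -> x < y -> cosh x < cosh y.
Proof.
have shE u : sinh u = sn 1 u by rewrite /sn oner_eq0 mul1r divr1.
apply: (@derive_incr _ _ (@sinh R) 0) => z; first by move=> _; exact: is_derive_cosh.
by move=> z0; rewrite shE sn_gt0.
Qed.

(** Monotonicity in k, at a fixed u > 0, passes from each function to its
primitive that vanishes at 0: from cosh to sn, to vs, to ms. The case k = 0 is included, which
compares the parabola directly with the hyperbolas. *)
Lemma cs_lt k l u : 0 <= k -> k < l -> 0 < u -> cs k u < cs l u.
Proof.
by move=> k0 kl u0; rewrite cosh_incr ?ltr_pM2r// mulr_ge0// ltW.
Qed.

Lemma sn_lt k l u : 0 <= k -> k < l -> 0 < u -> sn k u < sn l u.
Proof.
move=> k0 kl u0; rewrite -subr_gt0; move: u u0.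
apply: (@derive_pos _ (fun u => sn l u - sn k u)
  (fun u => cs l u - cs k u)).
- by move=> x; have ? := is_derive_sn l x; have ? := is_derive_sn k x; exact: is_deriveB.
- by rewrite !sn0 subrr.
- by move=> x x0; rewrite subr_gt0 cs_lt.
Qed.

Lemma vs_lt k l u : 0 <= k -> k < l -> 0 < u -> vs k u < vs l u.
Proof.
move=> k0 kl u0; rewrite -subr_gt0; move: u u0.
apply: (@derive_pos _ (fun u => vs l u - vs k u)
  (fun u => sn l u - sn k u)).
- by move=> x; have ? := is_derive_vs l x; have ? := is_derive_vs k x; exact: is_deriveB.
- by rewrite !vs0 subrr.
- by move=> x x0; rewrite subr_gt0 sn_lt.
Qed.

Lemma ms_lt k l u : 0 <= k -> k < l -> 0 < u -> ms k u < ms l u.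
Proof.
move=> k0 kl u0; rewrite -subr_gt0; move: u u0.
apply: (@derive_pos _ (fun u => ms l u - ms k u)
  (fun u => vs l u - vs k u)).
- by move=> x; have ? := is_derive_ms l x; have ? := is_derive_ms k x; exact: is_deriveB.
- by rewrite !ms0 subrr.
- by move=> x x0; rewrite subr_gt0 vs_lt.
Qed.

End positivity.

(** * Shape functions *)

Section shapes.
Context {R : realType}.
Implicit Types k x : R.

(** The areas of the enveloping triangle and of the convex hull for a subarc of
affine length 1 of the conic (sn, vs) with parameter x. *)
Definition tshape x := vs x 1 ^+ 2 / (2 * sn x 1).
Definition hshape x := ms x 1 / 2.

(** Homogeneity: the functions at (k, d) are powers of d times their values at
(k d, 1). It holds for k = 0 too. *)
Lemma sn_scale k d : d != 0 -> sn k d = d * sn (k * d) 1.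
Proof.
move=> d0; rewrite /sn mulr1 mulf_eq0 (negbTE d0) orbF.
by case: (eqVneq k 0) => [_|k0]; [rewrite mulr1|field; rewrite d0].
Qed.

Lemma vs_scale k d : d != 0 -> vs k d = d ^+ 2 * vs (k * d) 1.
Proof.
move=> d0; rewrite /vs mulr1 mulf_eq0 (negbTE d0) orbF.
by case: (eqVneq k 0) => [_|k0]; field; rewrite // d0.
Qed.

Lemma ms_scale k d : d != 0 -> ms k d = d ^+ 3 * ms (k * d) 1.
Proof.
move=> d0; rewrite /ms mulr1 mulf_eq0 (negbTE d0) orbF.
by case: (eqVneq k 0) => [_|k0]; field; rewrite // d0.
Qed.

Lemma tshapeE k d : d != 0 ->
  vs k d ^+ 2 / (2 * sn k d) = d ^+ 3 * tshape (k * d).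
Proof.
move=> d0; rewrite vs_scale// sn_scale// /tshape.
have s0 : sn (k * d) 1 != 0 by rewrite gt_eqF// sn_gt0.
by field; rewrite s0 d0.
Qed.

Lemma hshapeE k d : d != 0 -> ms k d / 2 = d ^+ 3 * hshape (k * d).
Proof. by move=> d0; rewrite ms_scale// /hshape mulrA. Qed.

Lemma tshape_gt0 x : 0 < tshape x.
Proof. by rewrite divr_gt0 ?exprn_gt0 ?mulr_gt0 ?vs_gt0 ?sn_gt0. Qed.

Lemma hshape_gt0 x : 0 < hshape x.
Proof. by rewrite divr_gt0 ?ms_gt0. Qed.

Lemma ms1E x : ms 1 x = sn 1 x - x.
Proof. by rewrite /ms /sn oner_eq0 expr1n !divr1. Qed.

Lemma cs1E x : cs 1 x = 1 + vs 1 x.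
Proof. by rewrite csE expr1n mul1r. Qed.

Lemma sn1_sq x : sn 1 x ^+ 2 = vs 1 x * (2 + vs 1 x).
Proof. by rewrite sn_sq cs1E; ring. Qed.

Let isd x := (is_derive_sn 1 x, is_derive_vs 1 x, is_derive_ms 1 x, is_derive_cs 1 x).

(** The derivatives of [tshape] and of [hshape / tshape] have the sign of this
one quantity. It vanishes at 0 to high order: three differentiations, each
again vanishing at 0, lead to x sn(x) > 0. *)
Lemma shape_wronskian_gt0 x : 0 < x ->
  0 < vs 1 x * sn 1 x - ms 1 x * cs 1 x - 2 * ms 1 x.
Proof.
move: x.
apply: (@derive_pos _ _ (fun x => vs 1 x ^+ 2 - ms 1 x * sn 1 x)) => [x||].
- have [[[? ?] ?] ?] := isd x; apply: is_derive_eq.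
  by rewrite /GRing.scale/= !cs1E; have := sn1_sq x => h; ring: h.
- by rewrite !(vs0, ms0); ring.
apply: (@derive_pos _ _ (fun x => vs 1 x * sn 1 x - ms 1 x * cs 1 x)) => [x||].
- have [[[? ?] ?] ?] := isd x; apply: is_derive_eq.
  by rewrite /GRing.scale/=; ring.
- by rewrite !(vs0, ms0); ring.
apply: (@derive_pos _ _ (fun x => sn 1 x * x)) => [x||x x0].
- have [[[? ?] ?] ?] := isd x; apply: is_derive_eq.
  by rewrite /GRing.scale/= ms1E; ring.
- by rewrite !(vs0, ms0); ring.
by rewrite mulr_gt0 ?sn_gt0.
Qed.

Lemma hshape_incr x y : 0 <= x -> x < y -> hshape x < hshape y.
Proof. by move=> x0 xy; rewrite ltr_pM2r// ms_lt. Qed.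

(** For x > 0 the shape functions are expressed with k = 1 and the variable x,
so that they can be differentiated; the value at 0 is treated apart. *)
Lemma tshape_sn1 x : 0 < x -> tshape x = vs 1 x ^+ 2 / (sn 1 x * x ^+ 3) / 2.
Proof.
move=> x0; have s0 := sn_gt0 1 x0.
have xn0 : x != 0 by rewrite gt_eqF.
rewrite (vs_scale 1 xn0) (sn_scale 1 xn0) mul1r /tshape.
have S0 := @sn_gt0 R x 1 ltr01.
by field; rewrite !gt_eqF.
Qed.

Lemma htshape_sn1 x : 0 < x ->
  hshape x / tshape x = ms 1 x * sn 1 x / vs 1 x ^+ 2.
Proof.
move=> x0; have xn0 : x != 0 by rewrite gt_eqF.
rewrite (vs_scale 1 xn0) (sn_scale 1 xn0) (ms_scale 1 xn0) mul1r /tshape /hshape.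
have S0 := @sn_gt0 R x 1 ltr01; have V0 := @vs_gt0 R x 1 ltr01.
by field; rewrite !gt_eqF.
Qed.

Lemma sn1_gtid x : 0 < x -> x < sn 1 x.
Proof. by move=> x0; rewrite -subr_gt0 -ms1E ms_gt0. Qed.

Let tshape_incr_pos x y : 0 < x -> x < y -> tshape x < tshape y.
Proof.
move=> x0 xy; rewrite (tshape_sn1 x0) (tshape_sn1 (lt_trans x0 xy)) ltr_pM2r//.
apply: (@ratio_incr _ (fun x => vs 1 x ^+ 2) (fun x => sn 1 x * x ^+ 3)
  (fun x => 2 * vs 1 x * sn 1 x)
  (fun x => cs 1 x * x ^+ 3 + sn 1 x * (3 * x ^+ 2)) 0) => // z.
- have [[[? ?] ?] ?] := isd z; apply: is_derive_eq.
  by rewrite /GRing.scale/=; ring.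
- have [[[? ?] ?] ?] := isd z; apply: is_derive_eq.
  by rewrite /GRing.scale/=; ring.
- by move=> z0; rewrite mulr_gt0 ?sn_gt0 ?exprn_gt0.
move=> z0.
have -> : 2 * vs 1 z * sn 1 z * (sn 1 z * z ^+ 3) -
    vs 1 z ^+ 2 * (cs 1 z * z ^+ 3 + sn 1 z * (3 * z ^+ 2)) =
    z ^+ 2 * vs 1 z ^+ 2 * (vs 1 z * sn 1 z - ms 1 z * cs 1 z - 2 * ms 1 z).
  by rewrite ms1E cs1E; have := sn1_sq z => h; ring: h.
by rewrite !mulr_gt0 ?exprn_gt0 ?vs_gt0 ?shape_wronskian_gt0.
Qed.

(** A lower bound that tends to the value at 0: with h = x / 2 the quantity is
(sinh h / h)^3 cosh x / cosh h. *)
Let tshape_ge x : 0 < x -> 1 <= 8 * tshape x * cosh x.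
Proof.
move=> x0; have h0 : 0 < x / 2 by rewrite divr_gt0.
rewrite tshape_sn1// [in vs 1 x](splitr x) [in sn 1 x](splitr x).
rewrite vs_double sn_double [in x ^+ 3](splitr x).
have lecosh : cs 1 (x / 2) <= cosh x.
  by rewrite /cs mul1r ltW// cosh_incr ?ltW// ltr_pdivrMr// mulr2n mulrDr mulr1 ltrDl.
have c0 := @cs_gt0 R 1 (x / 2).
have xs := ltW (sn1_gtid h0); move: (x / 2) h0 lecosh c0 xs (sn_gt0 1 h0).
move=> h h0 lec c0 xs s0.
have -> : 8 * ((2 * sn 1 h ^+ 2) ^+ 2 / (2 * sn 1 h * cs 1 h * (h + h) ^+ 3) / 2) * cosh x
   = (sn 1 h / h) ^+ 3 * (cosh x / cs 1 h).
  by field; rewrite !gt_eqF ?addr_gt0.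
by apply: mulr_ege1; [apply: exprn_ege1|]; rewrite ler_pdivlMr ?mul1r.
Qed.

Lemma tshape0 : tshape 0 = 8^-1.
Proof. by rewrite /tshape /vs /sn eqxx; field. Qed.

(** If tshape x were at most 1/8, then tshape (x / 2) < 1/8, and by monotonicity
8 tshape(e) would stay below a constant less than 1 for small e > 0, against
the lower bound 1 / cosh e. *)
Let tshape_gt8 x : 0 < x -> 8^-1 < tshape x.
Proof.
move=> x0; rewrite ltNge; apply/negP => tx.
have y0 : 0 < x / 2 by rewrite divr_gt0.
have yx : x / 2 < x by rewrite ltr_pdivrMr// mulr2n mulrDr mulr1 ltrDl.
have ty := lt_le_trans (tshape_incr_pos y0 yx) tx.
have t8 : 8 * tshape (x / 2) < 1 by rewrite mulrC -ltr_pdivlMr ?div1r.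
have ch : 8 * tshape (x / 2) * cosh e @[e --> 0^'+] --> 8 * tshape (x / 2).
  rewrite -[X in _ --> X]mulr1 -(@cosh0 R).
  apply: cvgMr; apply: cvg_at_right_filter.
  apply: differentiable_continuous; apply/derivable1_diffP.
  by have [] := is_derive_cosh (0 : R).
near (0 : R)^'+ => e.
have e0 : 0 < e by [].
have ey : e < x / 2 by near: e; exact: nbhs_right_lt.
have : 8 * tshape (x / 2) * cosh e < 1 by near: e; exact: cvgr_lt ch _ t8.
apply/negP; rewrite -leNgt (le_trans (tshape_ge e0))// ler_pM2r ?cosh_gt0//.
by rewrite ler_pM2l// ltW// tshape_incr_pos.
Unshelve. all: by end_near. Qed.

Lemma tshape_incr x y : 0 <= x -> x < y -> tshape x < tshape y.
Proof.
rewrite le_eqVlt => /predU1P[<-|]; last exact: tshape_incr_pos.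
by rewrite tshape0; exact: tshape_gt8.
Qed.

Let htshape_incr_pos x y : 0 < x -> x < y ->
  hshape x / tshape x < hshape y / tshape y.
Proof.
move=> x0 xy; rewrite (htshape_sn1 x0) (htshape_sn1 (lt_trans x0 xy)).
apply: (@ratio_incr _ (fun x => ms 1 x * sn 1 x) (fun x => vs 1 x ^+ 2)
  (fun x => vs 1 x * sn 1 x + ms 1 x * cs 1 x)
  (fun x => 2 * vs 1 x * sn 1 x) 0) => // z.
- have [[[? ?] ?] ?] := isd z; apply: is_derive_eq.
  by rewrite /GRing.scale/=; ring.
- have [[[? ?] ?] ?] := isd z; apply: is_derive_eq.
  by rewrite /GRing.scale/=; ring.
- by move=> z0; rewrite exprn_gt0 ?vs_gt0.
move=> z0.
have -> : (vs 1 z * sn 1 z + ms 1 z * cs 1 z) * vs 1 z ^+ 2 -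
    ms 1 z * sn 1 z * (2 * vs 1 z * sn 1 z) =
    vs 1 z ^+ 2 * (vs 1 z * sn 1 z - ms 1 z * cs 1 z - 2 * ms 1 z).
  by rewrite cs1E; have := sn1_sq z => h; ring: h.
by rewrite !mulr_gt0 ?exprn_gt0 ?vs_gt0 ?shape_wronskian_gt0.
Qed.

Lemma htshape0 : hshape 0 / tshape 0 = 2 / 3.
Proof. by rewrite tshape0 /hshape /ms eqxx; field. Qed.

(** The claim is 3 ms sn > 2 vs^2: the difference and its derivative vanish
at 0, and its second derivative is a sum of positive terms. *)
Let htshape_gt x : 0 < x -> 2 / 3 < hshape x / tshape x.
Proof.
move=> x0; rewrite (htshape_sn1 x0) ltr_pdivlMr ?exprn_gt0 ?vs_gt0// mulrAC.
rewrite ltr_pdivrMr// -subr_gt0; move: x x0.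
apply: (@derive_pos _ _ (fun x => 3 * (ms 1 x * cs 1 x) - vs 1 x * sn 1 x)) => [x||].
- have [[[? ?] ?] ?] := isd x; apply: is_derive_eq.
  by rewrite /GRing.scale/=; ring.
- by rewrite !(vs0, ms0); ring.
apply: (@derive_pos _ _ (fun x => vs 1 x ^+ 2 + 3 * (ms 1 x * sn 1 x))) => [x||x x0].
- have [[[? ?] ?] ?] := isd x; apply: is_derive_eq.
  by rewrite /GRing.scale/= cs1E; have := sn1_sq x => h; ring: h.
- by rewrite !(vs0, ms0); ring.
by rewrite addr_gt0 ?exprn_gt0 ?mulr_gt0 ?vs_gt0 ?ms_gt0 ?sn_gt0.
Qed.

Lemma htshape_incr x y : 0 <= x -> x < y ->
  hshape x / tshape x < hshape y / tshape y.
Proof.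
rewrite le_eqVlt => /predU1P[<-|]; last exact: htshape_incr_pos.
by rewrite htshape0; exact: htshape_gt.
Qed.

End shapes.

(** * Convex hulls and triangles *)

Section convexity.
Context {R : realType}.
Implicit Types (A B : set (R * R)) (P Q a b c : R * R) (t al be ga : R).

Definition comb t P Q : R * R :=
  (t * P.1 + (1 - t) * Q.1, t * P.2 + (1 - t) * Q.2).

(** Replaces the scalars of [0, 1] bundled with their bounds by plain reals. *)
Lemma convex_comb A : @convex_set R (R^o * R^o)%type A <->
  forall P Q t, 0 <= t <= 1 -> A P -> A Q -> A (comb t P Q).
Proof.
split=> [cA P Q t /andP[t0 t1] AP AQ|cA P Q t].
  have t01 : Itv.spec (@Itv.num_sem R) (Itv.Real `[0%Z, 1%Z]) t.
    by rewrite /= /Itv.num_sem /= in_itv/= t0 t1 num_real.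
  have := cA P Q (@Itv.mk _ (@Itv.num_sem R) (Itv.Real `[0%Z, 1%Z]) t t01).
  by rewrite !inE; exact.
rewrite !inE => AP AQ.
by have := cA P Q t%:num; rewrite ge0 le1; exact.
Qed.

Lemma convex_hull_comb A P Q t : 0 <= t <= 1 ->
  convex_hull A P -> convex_hull A Q -> convex_hull A (comb t P Q).
Proof.
move=> t01 AP AQ X [cX AX]; move/convex_comb: (cX); apply=> //.
- exact: AP.
- exact: AQ.
Qed.

Lemma sub_convex_hull A : A `<=` convex_hull A.
Proof. exact: sub_gen_smallest. Qed.

Lemma convex_hull_sub A B :
  (forall P Q t, 0 <= t <= 1 -> B P -> B Q -> B (comb t P Q)) ->
  A `<=` B -> convex_hull A `<=` B.
Proof. by move=> /convex_comb cB; exact: smallest_sub. Qed.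

(** Twice the signed area of the triangle a b c. *)
Definition det3 a b c := (b.1 - a.1) * (c.2 - a.2) - (b.2 - a.2) * (c.1 - a.1).

Lemma collinearE a b c : collinear a b c <-> det3 a b c = 0.
Proof. by rewrite /collinear /det3; split=> [->|/subr0_eq//]; rewrite subrr. Qed.

Lemma det3_comb t P Q a b :
  det3 a b (comb t P Q) = t * det3 a b P + (1 - t) * det3 a b Q.
Proof. by rewrite /det3 /comb /=; ring. Qed.

Lemma det3_rot a b c : det3 a b c = det3 b c a.
Proof. by rewrite /det3; ring. Qed.

(** The points on the inner side of each side of a b c. The factor det3 a b c
makes this independent of the orientation of the triangle. *)
Definition sides a b c := [set P | [/\ 0 <= det3 a b c * det3 b c P,
  0 <= det3 a b c * det3 c a P & 0 <= det3 a b c * det3 a b P]].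

Lemma barycentric a b c P :
  det3 a b c * P.1 = det3 b c P * a.1 + det3 c a P * b.1 + det3 a b P * c.1 /\
   det3 a b c * P.2 = det3 b c P * a.2 + det3 c a P * b.2 + det3 a b P * c.2.
Proof. by rewrite /det3; split; ring. Qed.

(** Two binary combinations suffice: first of b and c, with weight
be / (be + ga), then with a. When be + ga = 0 the weight is 0, which is
harmless. *)
Lemma triangle_comb a b c al be ga : 0 <= al -> 0 <= be -> 0 <= ga ->
  al + be + ga = 1 ->
  triangle a b c (al * a.1 + be * b.1 + ga * c.1, al * a.2 + be * b.2 + ga * c.2).
Proof.
move=> al0 be0 ga0 sum1.
have al1 : 1 - al = be + ga by rewrite -sum1; ring.
set t := be / (be + ga).
have bg0 : 0 <= be + ga by rewrite addr_ge0.
have t01 : 0 <= t <= 1.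
  rewrite divr_ge0//= /t; have [->|bgn0] := eqVneq (be + ga) 0.
    by rewrite invr0 mulr0.
  by rewrite ler_pdivrMr ?lt_neqAle ?(eq_sym 0) ?bgn0// mul1r lerDl.
have tbe : (be + ga) * t = be.
  rewrite /t; have [bge|bgn] := eqVneq (be + ga) 0; last by rewrite mulrC divfK.
  by move: bge => /eqP; rewrite paddr_eq0// => /andP[/eqP-> _]; rewrite mul0r mulr0.
have tga : (be + ga) * (1 - t) = ga by rewrite mulrBr mulr1 tbe; ring.
clearbody t.
have -> : (al * a.1 + be * b.1 + ga * c.1, al * a.2 + be * b.2 + ga * c.2) =
    comb al a (comb t b c).
  have e x y : (be + ga) * (t * x + (1 - t) * y) = be * x + ga * y.
    by rewrite mulrDr !mulrA tbe tga.
  by rewrite /comb/= al1 !e !addrA.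
apply: convex_hull_comb.
- by rewrite al0/= -subr_ge0 al1.
- by apply: sub_convex_hull; left; left.
apply: convex_hull_comb.
- by [].
- by apply: sub_convex_hull; left; right.
- by apply: sub_convex_hull; right.
Qed.

(** The determinants of P with the sides, divided by det3 a b c, are the
barycentric coordinates of P. *)
Lemma triangle_sides a b c : det3 a b c != 0 -> triangle a b c = sides a b c.
Proof.
move=> D0; rewrite eqEsubset; split.
  apply: convex_hull_sub.
    move=> P Q t /andP[t0 t1] [P1 P2 P3] [Q1 Q2 Q3].
    by split; rewrite det3_comb mulrDr !(mulrCA (det3 _ _ _)) addr_ge0// mulr_ge0// subr_ge0.
  have D2 : 0 <= det3 a b c * det3 a b c by rewrite -expr2 sqr_ge0.
  have d0 p q : det3 p q p = 0 by rewrite /det3; ring.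
  have d0' p q : det3 p q q = 0 by rewrite /det3; ring.
  have r1 : det3 b c a = det3 a b c by rewrite -det3_rot.
  have r2 : det3 c a b = det3 a b c by rewrite det3_rot.
  by move=> P /= [[->|->]|->]; split; rewrite ?r1 ?r2 ?d0 ?d0' ?mulr0.
move=> [x y] [P1 P2 P3].
have [] := barycentric a b c (x, y); set D := det3 a b c in D0 P1 P2 P3 *.
set u := det3 b c _; set v := det3 c a _; set w := det3 a b _ => Ex Ey.
have pos z : 0 <= D * z -> 0 <= z / D.
  by move=> Dz; rewrite (_ : z / D = D * z / D ^+ 2) ?divr_ge0 ?sqr_ge0//; field.
have -> : (x, y) = (u / D * a.1 + v / D * b.1 + w / D * c.1,
                   u / D * a.2 + v / D * b.2 + w / D * c.2).
  by congr pair; apply: (mulfI D0); rewrite ?Ex ?Ey; field.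
apply: triangle_comb; [exact: pos..|].
by rewrite -!mulrDl (_ : u + v + w = D) ?divff// /u /v /w /D /det3/=; ring.
Qed.

Lemma triangle_sub a b c a' b' c' : triangle a b c a' -> triangle a b c b' ->
  triangle a b c c' -> triangle a' b' c' `<=` triangle a b c.
Proof.
move=> ha hb hc; apply: convex_hull_sub => [P Q t|P /= [[->|->]|->]//].
exact: convex_hull_comb.
Qed.

Lemma triangle_swap a b c : triangle a b c = triangle b a c.
Proof. by rewrite /triangle (setUC [set a]). Qed.

End convexity.

(** * Areas *)

Section area_between.
Context {R : realType}.
Local Notation mu := (@lebesgue_measure R).
Implicit Types (f g : R -> R) (a b c : R).

(** The product measure is by definition the integral of the lengths of the
vertical sections. *)
Lemma area_between (A : set (R * R)) f g a b :
  (forall x, a <= x -> x <= b -> f x <= g x) ->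
  (forall x y, A (x, y) <-> [/\ a <= x, x <= b, f x <= y & y <= g x]) ->
  area A = (\int[mu]_(x in `[a, b]) (g x - f x)%:E)%E.
Proof.
move=> fg AE; rewrite [RHS]integral_mkcond.
apply: eq_integral => x _ /=; rewrite patchE; case: ifPn => xab.
  move: xab; rewrite inE/= in_itv/= => /andP[ax xb].
  rewrite (_ : xsection A x = `[f x, g x]%classic).
    by rewrite lebesgue_measure_itv/= lte_fin; case: ltgtP (fg x ax xb) => // -> _; rewrite subrr.
  apply/seteqP; split=> y.
    by move=> /xsectionP/AE[_ _ fy yg]; rewrite /= in_itv/= fy.
  by rewrite /= in_itv/= => /andP[fy yg]; apply/xsectionP/AE.
rewrite (_ : xsection A x = set0) ?measure0// -subset0 => y /xsectionP/AE[ax xb _ _].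
by move/negP: xab; apply; rewrite inE/= in_itv/= ax.
Qed.

Lemma integral_derivative (f F : R -> R) a b : a <= b ->
  (forall x : R, is_derive x 1 F (f x)) -> continuous f ->
  (\int[mu]_(x in `[a, b]) (f x)%:E = (F b - F a)%:E)%E.
Proof.
rewrite le_eqVlt => /predU1P[->|ab] Ff cf.
  by rewrite set_itv1 integral_set1 subrr.
have cF : continuous F.
  move=> x; apply: differentiable_continuous; apply/derivable1_diffP.
  by have [] := Ff x.
rewrite EFinB; apply: continuous_FTC2 => //.
- exact: continuous_subspaceT.
- split.
  + by move=> x _; have [] := Ff x.
  + exact/cvg_at_right_filter/cF.
  + exact/cvg_at_left_filter/cF.
- by move=> x _; rewrite derive1E; have [_ ->] := Ff x.
Qed.

Lemma ge0_integral_split f a c b : a <= c -> c <= b -> continuous f ->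
  (forall x, a <= x -> x <= b -> 0 <= f x) ->
  (\int[mu]_(x in `[a, b]) (f x)%:E =
   \int[mu]_(x in `[a, c]) (f x)%:E + \int[mu]_(x in `[c, b]) (f x)%:E)%E.
Proof.
move=> ac cb cf f0.
have mf (D : set R) : measurable_fun D f.
  by apply: measurable_funTS; exact: continuous_measurable_fun.
have E : `[a, b]%classic = `[a, c[%classic `|` `[c, b]%classic :> set R.
  by apply: itv_bndbnd_setU; rewrite bnd_simp.
rewrite -(@integral_itv_bndo_bndc _ _ c); last exact/measurable_EFinP.
rewrite E ge0_integral_setU//.
- by apply/measurable_EFinP; exact: mf.
- by move=> x; rewrite -E/= in_itv/= lee_fin => /andP[ax xb]; exact: f0.
- apply/disj_setPS => x; rewrite /= !in_itv/= => -[/andP[_ xc] /andP[cx _]].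
  by move: (lt_le_trans xc cx); rewrite ltxx.
Qed.

(** The heights of the vertical sections of a triangle form a tent of height H
over the base [a, b]. *)
Lemma integral_tent H a c b : a < c -> c < b -> 0 <= H ->
  (\int[mu]_(x in `[a, b])
     (Num.min (H / (c - a) * (x - a)) (H / (b - c) * (b - x)))%:E =
   (H * (b - a) / 2)%:E)%E.
Proof.
move=> ac cb H0.
have ca0 : c - a != 0 by rewrite gt_eqF ?subr_gt0.
have bc0 : b - c != 0 by rewrite gt_eqF ?subr_gt0.
set l := fun x => H / (c - a) * (x - a); set r := fun x => H / (b - c) * (b - x).
have cl : continuous l.
  by move=> x; apply: cvgMr; apply: cvgB; [exact: cvg_id|exact: cvg_cst].
have cr : continuous r.
  by move=> x; apply: cvgMr; apply: cvgB; [exact: cvg_cst|exact: cvg_id].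
have k1 : 0 <= H / (c - a) by rewrite divr_ge0// subr_ge0 ltW.
have k2 : 0 <= H / (b - c) by rewrite divr_ge0// subr_ge0 ltW.
have lc : l c = H by rewrite /l divfK.
have rc : r c = H by rewrite /r divfK.
have lle x y : x <= y -> l x <= l y by move=> xy; rewrite ler_wpM2l// lerD2r.
have rle x y : x <= y -> r y <= r x by move=> xy; rewrite ler_wpM2l// lerD2l lerN2.
have cm : continuous (fun x => Num.min (l x) (r x)).
  by move=> x; exact: (@continuous_min R R l r x (cl x) (cr x)).
have m0 x : a <= x -> x <= b -> 0 <= Num.min (l x) (r x).
  by move=> ax xb; rewrite le_min; apply/andP; split; apply: mulr_ge0; rewrite ?subr_ge0.
rewrite (ge0_integral_split (ltW ac) (ltW cb) cm m0).
have -> : (\int[mu]_(x in `[a, c]) (Num.min (l x) (r x))%:E =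
    \int[mu]_(x in `[a, c]) (l x)%:E)%E.
  apply: eq_integral => x; rewrite inE/= in_itv/= => /andP[ax xc]; rewrite min_l//.
  by rewrite (le_trans (lle _ _ xc))// lc -rc rle.
have -> : (\int[mu]_(x in `[c, b]) (Num.min (l x) (r x))%:E =
    \int[mu]_(x in `[c, b]) (r x)%:E)%E.
  apply: eq_integral => x; rewrite inE/= in_itv/= => /andP[cx xb]; rewrite min_r//.
  by rewrite (le_trans (rle _ _ cx))// rc -lc lle.
have dl (x : R) : is_derive x 1 (fun x => H / (c - a) * ((x - a) ^+ 2 / 2)) (l x).
  by apply: is_derive_eq; rewrite /l /GRing.scale/=; field.
have dr (x : R) : is_derive x 1 (fun x => - (H / (b - c) * ((b - x) ^+ 2 / 2))) (r x).
  by apply: is_derive_eq; rewrite /r /GRing.scale/=; field.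
rewrite (integral_derivative (ltW ac) dl cl) (integral_derivative (ltW cb) dr cr).
by rewrite -EFinD; congr EFin; field; rewrite bc0 ca0.
Qed.

(** The edge from a to b has to be the lower one and c has to lie above its
interior, for the sections to be intervals between two graphs. *)
Lemma area_triangle (a b c : R * R) : a.1 < c.1 -> c.1 < b.1 ->
  0 < det3 a b c -> area (triangle a b c) = (det3 a b c / 2)%:E.
Proof.
move=> ac cb D0; have ab := lt_trans ac cb.
rewrite triangle_sides ?gt_eqF//.
set H := det3 a b c / (b.1 - a.1).
have H0 : 0 <= H by rewrite divr_ge0 ?ltW// subr_gt0.
have ab0 : b.1 - a.1 != 0 by rewrite gt_eqF ?subr_gt0.
have ca0 : c.1 - a.1 != 0 by rewrite gt_eqF ?subr_gt0.
have bc0 : b.1 - c.1 != 0 by rewrite gt_eqF ?subr_gt0.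
pose f x := a.2 + (b.2 - a.2) / (b.1 - a.1) * (x - a.1).
pose h x := Num.min (H / (c.1 - a.1) * (x - a.1)) (H / (b.1 - c.1) * (b.1 - x)).
rewrite (@area_between _ f (fun x => f x + h x) a.1 b.1); first last.
- move=> x y; rewrite /sides/= !pmulr_rge0//.
  have e1 : det3 a b (x, y) = (b.1 - a.1) * (y - f x).
    by rewrite /det3 /f/=; field.
  have e2 : det3 c a (x, y) =
      (c.1 - a.1) * (f x + H / (c.1 - a.1) * (x - a.1) - y).
    by rewrite /H /det3 /f/=; field; rewrite ab0 ca0.
  have e3 : det3 b c (x, y) =
      (b.1 - c.1) * (f x + H / (b.1 - c.1) * (b.1 - x) - y).
    by rewrite /H /det3 /f/=; field; rewrite ab0 bc0.
  rewrite e1 e2 e3 !pmulr_rge0 ?subr_gt0// !subr_ge0 /h.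
  rewrite addr_minr le_min; split=> [[y3 y2 y1]|[_ _ y1 /andP[y2 y3]]//].
  have Hp : 0 < H by rewrite divr_gt0// subr_gt0.
  rewrite y1 y2 y3; split=> //.
    have := le_trans y1 y2; rewrite lerDl pmulr_rge0 ?subr_ge0//.
    by rewrite divr_gt0// subr_gt0.
  have := le_trans y1 y3; rewrite lerDl pmulr_rge0 ?subr_ge0//.
  by rewrite divr_gt0// subr_gt0.
- move=> x ax xb; rewrite lerDl le_min; apply/andP; split.
    by apply: mulr_ge0; [apply: divr_ge0|]; rewrite // subr_ge0 // ltW.
  by apply: mulr_ge0; [apply: divr_ge0|]; rewrite // subr_ge0 // ltW.
under eq_integral do rewrite addrC addKr.
rewrite integral_tent//; congr EFin.
by rewrite /H; field.
Qed.

End area_between.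

(** * Arcs and their parametrizations *)

Section inverse.
Context {R : realType}.
Variable k : R.

(** The inverse of sn; the logarithmic form of the inverse hyperbolic sine. *)
Definition asn (z : R) :=
  if k == 0 then z else ln (k * z + Num.sqrt (1 + (k * z) ^+ 2)) / k.

Lemma snK : cancel (sn k) asn.
Proof.
move=> u; rewrite /asn /sn; case: eqVneq => // k0.
rewrite (mulrC k (_ / k)) divfK// -cosh_sq sqrtr_sqr gtr0_norm ?cosh_gt0//.
rewrite (_ : sinh _ + cosh _ = expR (k * u)); last by rewrite /sinh /cosh; field.
by rewrite expRK mulrAC divff ?mul1r.
Qed.

Lemma asnK : cancel asn (sn k).
Proof.
move=> z; rewrite /asn /sn; case: eqVneq => // k0.
set y := k * z; set w := y + _.
have s2 : Num.sqrt (1 + y ^+ 2) ^+ 2 = 1 + y ^+ 2.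
  by rewrite sqr_sqrtr// addr_ge0 ?sqr_ge0.
have wV : w * (Num.sqrt (1 + y ^+ 2) - y) = 1.
  by rewrite /w; ring: s2.
have w0 : 0 < w.
  have y1 : `|y| < Num.sqrt (1 + y ^+ 2).
    by rewrite -sqrtr_sqr ltr_sqrt ?ltrDr// ltr_pwDl// sqr_ge0.
  by rewrite /w -ltrBlDl sub0r (le_lt_trans _ y1)// -normrN ler_norm.
have winv : w^-1 = Num.sqrt (1 + y ^+ 2) - y.
  by apply: (mulfI (lt0r_neq0 w0)); rewrite divff ?gt_eqF.
rewrite (mulrC k (_ / k)) divfK// /sinh expRN lnK ?posrE// winv /w /y.
by field.
Qed.

Lemma continuous_sn : continuous (sn k).
Proof.
move=> x; apply: differentiable_continuous; apply/derivable1_diffP.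
by have [] := is_derive_sn k x.
Qed.

Lemma is_derive_asn (z : R) : is_derive z 1 asn (cs k (asn z))^-1.
Proof.
rewrite -{1}(asnK z); apply: is_derive_inverse.
- by near=> x; exact: snK.
- by near=> x; exact: continuous_sn.
- exact: is_derive_sn.
- by rewrite gt_eqF// cs_gt0.
Unshelve. all: by end_near. Qed.

Lemma continuous_asn : continuous asn.
Proof.
move=> x; apply: differentiable_continuous; apply/derivable1_diffP.
by have [] := is_derive_asn x.
Qed.

End inverse.

Section arcs.
Context {R : realType}.
Variables (k A B x0 y0 : R).
Hypotheses (A0 : 0 < A) (B0 : 0 < B).
Implicit Types (p q u t : R) (P : R * R) (C : set (R * R)).

(** An affine image of the conic (sn, vs), of Jacobian A B in absolute value.
The sign of vs is reversed since the curves H are graphs of concave functions,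
and the abscissa increases with u. *)
Definition curveX u := x0 + A * sn k u.
Definition curveY u := y0 - B * vs k u.
Definition curvePt u : R * R := (curveX u, curveY u).
Definition curveArc p q := [set curvePt u | u in `[p, q]].
(** The parameter of a point of the curve is read off its abscissa. *)
Definition coord P := asn k ((P.1 - x0) / A).

Lemma curvePtK : cancel curvePt coord.
Proof.
by move=> u; rewrite /coord /curvePt /curveX /= addrC addKr mulrAC divff ?mul1r ?snK// gt_eqF.
Qed.

Lemma curvePt_inj : injective curvePt.
Proof. exact: can_inj curvePtK. Qed.

Lemma curveX_incr p q : p < q -> curveX p < curveX q.
Proof. by move=> pq; rewrite ltrD2l ltr_pM2l// sn_incr. Qed.

Lemma curveX_le p q : p <= q -> curveX p <= curveX q.
Proof. by rewrite le_eqVlt => /predU1P[->//|/curveX_incr/ltW]. Qed.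

Lemma continuous_coord : continuous coord.
Proof.
move=> P; apply: (@continuous_comp _ _ _ (fun P => (P.1 - x0) / A) (asn k)).
  by apply: cvgMl; apply: cvgB; [exact: cvg_fst|exact: cvg_cst].
exact: continuous_asn.
Qed.

Lemma continuous_curveX : continuous curveX.
Proof.
move=> u; apply: cvgD; first exact: cvg_cst.
by apply: cvgMr; exact: continuous_sn.
Qed.

Lemma continuous_curveY : continuous curveY.
Proof.
move=> u; apply: cvgB; first exact: cvg_cst.
apply: cvgMr; apply: differentiable_continuous; apply/derivable1_diffP.
by have [] := is_derive_vs k u.
Qed.

Lemma continuous_curvePt : continuous curvePt.
Proof.
move=> u.
exact: cvg_pair (@continuous_curveX u) (@continuous_curveY u).
Qed.

Lemma arc_inj p q p' q' : p <= q -> p' <= q' -> curveArc p q = curveArc p' q' ->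
  p = p' /\ q = q'.
Proof.
move=> pq pq' E.
have sub a b a' b' : curveArc a b `<=` curveArc a' b' -> a <= b -> a' <= a /\ b <= b'.
  move=> s ab.
  have [u] : curveArc a' b' (curvePt a) by apply: s; exists a; rewrite //= bound_itvE.
  rewrite /= in_itv/= => /andP[ua _] /curvePt_inj ue.
  have [v] : curveArc a' b' (curvePt b) by apply: s; exists b; rewrite //= bound_itvE.
  rewrite /= in_itv/= => /andP[_ vb] /curvePt_inj ve.
  by rewrite -{1}ue -ve.
have [h1 h2] : p' <= p /\ q <= q' by apply: sub => //; rewrite E.
have [h3 h4] : p <= p' /\ q' <= q by apply: sub => //; rewrite E.
by split; apply/le_anti; rewrite ?h1 ?h2 ?h3 ?h4.
Qed.

Section parametrization.
Variables (g : R -> R * R) (C : set (R * R)).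
Hypotheses (gC : simple_param g C) (CP : C `<=` range curvePt).
Let phi := coord \o g.

Lemma param_coord t : t \in `[0, 1] -> g t = curvePt (phi t).
Proof.
move=> t01; case: gC => _ _ gE.
have [u _ ue] : range curvePt (g t) by apply: CP; rewrite -gE; exists t.
by rewrite /phi /= -ue curvePtK.
Qed.

Lemma param_coord_cont : {within `[0, 1], continuous phi}.
Proof.
case: gC => /subspace_continuousP cg _ _; apply/subspace_continuousP => t t01.
by apply: cvg_comp; [exact: cg|exact: continuous_coord].
Qed.

Lemma param_coord_inj : {in `[0, 1] &, injective phi}.
Proof.
case: gC => _ gi _ s t s01 t01 st; apply: gi => //.
by rewrite (param_coord s01) (param_coord t01) st.
Qed.

Lemma param_coord_neq : phi 0 != phi 1.
Proof.
apply/eqP => /param_coord_inj; rewrite !bound_itvE !ler01 => /(_ isT isT)/eqP.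
by rewrite eq_sym oner_eq0.
Qed.

(** A simple curve on the conic moves monotonically along it, so it is the
subarc between its ends. *)
Lemma param_arc : C = curveArc (Num.min (phi 0) (phi 1)) (Num.max (phi 0) (phi 1)).
Proof.
case: gC => _ _ gE.
have := continuous_inj_image_segment ler01 param_coord_cont param_coord_inj.
rewrite /curveArc => <-.
rewrite -gE image_comp; apply: eq_imagel => t /= t01.
exact: param_coord.
Qed.

End parametrization.

Lemma extremities_arc p q a b : p < q -> extremities (curveArc p q) a b ->
  (a = curvePt p /\ b = curvePt q) \/ (a = curvePt q /\ b = curvePt p).
Proof.
move=> pq [g [gC <- <-]].
have sub : curveArc p q `<=` range curvePt by move=> _ [u _ <-]; exists u.
rewrite (param_coord gC sub) ?bound_itvE// (param_coord gC sub) ?bound_itvE//.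
have := param_arc gC sub; have := param_coord_neq gC sub.
set a' := _ 0; set b' := _ 1 => ab' /arc_inj[].
- exact: ltW.
- by rewrite ge_min le_max lexx.
by move: ab'; case: (ltgtP a' b') => // ab _ -> ->; [left|right].
Qed.

Lemma linear_param p q : p < q ->
  simple_param (curvePt \o (fun t => p + t * (q - p))) (curveArc p q).
Proof.
move=> pq; pose l t := p + t * (q - p).
split.
- apply: continuous_subspaceT => t; apply: continuous_comp; last exact: continuous_curvePt.
  by apply: cvgD; [exact: cvg_cst|apply: cvgMl; exact: cvg_id].
- move=> s t _ _ /curvePt_inj /addrI /mulIf -> //.
  by rewrite subr_eq0 gt_eqF.
have qp0 : 0 < q - p by rewrite subr_gt0.
rewrite -image_comp; congr image; apply/seteqP; split=> [_ [t /= + <-]|u /=].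
  rewrite !in_itv/= => /andP[t0 t1].
  by rewrite lerDl mulr_ge0 ?(ltW qp0)//= -lerBrDl ger_pMl.
rewrite in_itv/= => /andP[pu uq]; exists ((u - p) / (q - p)).
  rewrite /= in_itv/= divr_ge0 ?subr_ge0 ?(ltW pq)//=.
  by rewrite ler_pdivrMr// mul1r lerD2r.
by rewrite divfK ?gt_eqF// subrKC.
Qed.

Lemma arc_extremities p q : p < q ->
  extremities (curveArc p q) (curvePt p) (curvePt q).
Proof.
move=> pq; exists (curvePt \o (fun t => p + t * (q - p))).
by split; rewrite /= ?mul0r ?addr0 ?mul1r ?subrKC//; exact: linear_param.
Qed.

End arcs.

(** * Convexity of the arc, tangents and chords *)

Section identities.
Context {R : realType}.
Implicit Types k d e p u : R.

Lemma cs_sq k u : cs k u ^+ 2 = 1 + k ^+ 2 * sn k u ^+ 2.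
Proof. by rewrite sn_sq csE; ring. Qed.

Lemma vs_ge0 k u : 0 <= vs k u.
Proof.
have [u0|u0|->] := ltgtP u 0; last by rewrite vs0.
  by rewrite -vsN ltW// vs_gt0// oppr_gt0.
by rewrite ltW// vs_gt0.
Qed.

Lemma sn_ge0 k u : 0 <= u -> 0 <= sn k u.
Proof. by rewrite le_eqVlt => /predU1P[<-|/sn_gt0/ltW//]; rewrite sn0. Qed.

(** Up to the factor A B, twice the area of a triangle inscribed in the conic;
the factorization gives its sign. *)
Lemma chordE k d e : vs k d * sn k e - sn k d * vs k e =
  4 * (sn k (d / 2) * sn k (e / 2) * sn k ((d - e) / 2)).
Proof.
have half (x : R) : x = x / 2 + x / 2 by exact: splitr.
rewrite [in vs k d](half d) [in sn k e](half e) [in sn k d](half d) [in vs k e](half e).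
rewrite !vs_double !sn_double mulrBl snD snN vsN.
have h : k ^+ 2 * vs k (e / 2) = cs k (e / 2) - 1 by rewrite csE; ring.
by ring: h.
Qed.

Lemma chord_ge0 k d e : 0 <= e -> e <= d ->
  0 <= vs k d * sn k e - sn k d * vs k e.
Proof.
move=> e0 ed; rewrite chordE !mulr_ge0// sn_ge0// divr_ge0// ?subr_ge0//.
exact: le_trans ed.
Qed.

Lemma chord_gt0 k d e : 0 < e -> e < d ->
  0 < vs k d * sn k e - sn k d * vs k e.
Proof.
move=> e0 ed; rewrite chordE !mulr_gt0// sn_gt0// divr_gt0// ?subr_gt0//.
exact: lt_trans ed.
Qed.

(** Since vs(e) = o(sn(e)), the sign on the right of 0 is that of the
coefficient of sn. With sn (2 h) = 2 sn h cs h and vs (2 h) = 2 (sn h)^2, the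
combination is 2 sn h (cs h al + sn h be), and the last factor tends to al. *)
Lemma first_order_ge0 k d al be : 0 < d ->
  (forall e, 0 < e -> e <= d -> 0 <= sn k e * al + vs k e * be) -> 0 <= al.
Proof.
move=> d0 H; rewrite leNgt; apply/negP => al0.
have c0 : cs k h * al + sn k h * be @[h --> 0^'+] --> al.
  rewrite -[X in _ --> X]addr0 -{2}(mul0r be) -{2}(sn0 k) -[in X in _ --> X](mul1r al) -(cs0 k).
  apply: cvgD; apply: cvgMl; apply: cvg_at_right_filter; last exact: continuous_sn.
  apply: differentiable_continuous; apply/derivable1_diffP.
  by have [] := is_derive_cs k (0 : R).
near (0 : R)^'+ => h.
have h0 : 0 < h by [].
have hd : h + h <= d.
  rewrite [d]splitr lerD//; near: h; apply: nbhs_right_le; exact: divr_gt0.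
have hlt : cs k h * al + sn k h * be < 0 by near: h; exact: cvgr_lt c0 _ al0.
have := H _ (addr_gt0 h0 h0) hd; apply/negP; rewrite -ltNge sn_double vs_double.
rewrite (_ : _ + _ = 2 * sn k h * (cs k h * al + sn k h * be)); last by ring.
by rewrite pmulr_rlt0// mulr_gt0// sn_gt0.
Unshelve. all: by end_near. Qed.

End identities.

Section hull_and_triangle.
Context {R : realType}.
Variables (k A B x0 y0 : R).
Hypotheses (A0 : 0 < A) (B0 : 0 < B).
Local Notation px := (curveX k A x0).
Local Notation py := (curveY k B y0).
Local Notation pt := (curvePt k A B x0 y0).
Local Notation arc := (curveArc k A B x0 y0).
Local Notation mu := (@lebesgue_measure R).
Implicit Types (p q u t e : R) (P : R * R) (C : set (R * R)).

(** The equation of the tangent at parameter u, nonpositive on the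
side of the curve. *)
Definition tang u P := A * cs k u * (P.2 - py u) + B * sn k u * (P.1 - px u).

Lemma curveX_taylor p e :
  px (p + e) - px p = A * (cs k p * sn k e + k ^+ 2 * sn k p * vs k e).
Proof. by rewrite /px snD; ring. Qed.

Lemma curveY_taylor p e :
  py (p + e) - py p = - B * (sn k p * sn k e + cs k p * vs k e).
Proof. by rewrite /py vsD; ring. Qed.

Lemma tang_arc p e : tang p (pt (p + e)) = - (A * B * vs k e).
Proof.
rewrite /tang /pt/= curveX_taylor curveY_taylor; have h := cs_sq k p.
by ring: h.
Qed.

Lemma det3_arc p d e : det3 (pt p) (pt (p + d)) (pt (p + e)) =
  A * B * (vs k d * sn k e - sn k d * vs k e).
Proof.
rewrite /det3 /pt/= !curveX_taylor !curveY_taylor; have h := cs_sq k p.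
by ring: h.
Qed.

Lemma tang_arc_le0 p u : tang p (pt u) <= 0.
Proof.
rewrite -(subrKC p u) tang_arc oppr_le0.
by rewrite mulr_ge0 ?vs_ge0// mulr_ge0// ltW.
Qed.

Lemma det3_arc_ge0 p q u : p <= u -> u <= q -> 0 <= det3 (pt p) (pt q) (pt u).
Proof.
move=> pu uq; rewrite -(subrKC p u) -(subrKC p q) det3_arc.
apply: mulr_ge0; first by rewrite mulr_ge0 ?ltW.
by rewrite chord_ge0 ?subr_ge0// lerD2r.
Qed.

Lemma det3_arc_gt0 p q u : p < u -> u < q -> 0 < det3 (pt p) (pt q) (pt u).
Proof.
move=> pu uq; rewrite -(subrKC p u) -(subrKC p q) det3_arc.
apply: mulr_gt0; first exact: mulr_gt0.
by rewrite chord_gt0 ?subr_gt0// ltrD2r.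
Qed.

Definition chord p q x := py p + (py q - py p) / (px q - px p) * (x - px p).
Definition graph x := py (asn k ((x - x0) / A)).

Lemma graph_curveX u : graph (px u) = py u.
Proof. by rewrite /graph /px addrC addKr mulrAC divff ?mul1r ?snK// gt_eqF. Qed.

Lemma curveX_surj p q x : p <= q -> px p <= x -> x <= px q ->
  exists u, [/\ p <= u, u <= q & x = px u].
Proof.
move=> pq px_x x_qx; pose u := asn k ((x - x0) / A).
have xu : x = px u by rewrite /u /px asnK mulrC divfK ?subrKC// gt_eqF.
exists u; split=> //; rewrite leNgt; apply/negP => /(curveX_incr k x0 A0).
  by rewrite -xu ltNge px_x.
by rewrite -xu ltNge x_qx.
Qed.

Lemma det3_chord p q P : p < q ->
  det3 (pt p) (pt q) P = (px q - px p) * (P.2 - chord p q P.1).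
Proof.
move=> pq; have := curveX_incr k x0 A0 pq; rewrite -subr_gt0 => d0.
by rewrite /det3 /chord /pt/=; field; rewrite gt_eqF.
Qed.

Lemma chord_le_graph p q x : p < q -> px p <= x -> x <= px q ->
  chord p q x <= graph x.
Proof.
move=> pq px_x x_qx; have [u [pu uq xu]] := curveX_surj (ltW pq) px_x x_qx.
have := det3_arc_ge0 pu uq; rewrite det3_chord//= pmulr_rge0 ?subr_ge0.
  by rewrite xu graph_curveX.
by rewrite subr_gt0; exact: curveX_incr.
Qed.

(** The hull lies in the region bounded by the chord and all the tangents, which
is convex as an intersection of half-planes. Conversely a point between the
chord and the graph is on a vertical segment joining a point of the chord to a
point of the arc. *)
Lemma convex_hull_arc p q x y : p < q -> convex_hull (arc p q) (x, y) <->
  [/\ px p <= x, x <= px q, chord p q x <= y & y <= graph x].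
Proof.
move=> pq; have dpx := curveX_incr k x0 A0 pq.
have dpx0 : 0 < px q - px p by rewrite subr_gt0.
split=> [|[px_x x_qx cy yg]].
  (* The tangents at all parameters are used, not only those of the arc. *)
  pose H := [set P | [/\ px p <= P.1, P.1 <= px q, 0 <= det3 (pt p) (pt q) P &
    forall u, tang u P <= 0]].
  suff HH : convex_hull (arc p q) `<=` H.
    move=> /HH[/= h1 h2 h3 h4]; split=> //.
      by move: h3; rewrite det3_chord//= pmulr_rge0// subr_ge0.
    have [u [_ _ xu]] := curveX_surj (ltW pq) h1 h2.
    have := h4 u; rewrite /tang/= xu subrr mulr0 addr0 graph_curveX.
    by rewrite pmulr_rle0 ?subr_le0// mulr_gt0// cs_gt0.
  apply: convex_hull_sub => [P Q t /andP[t0 t1] [P1 P2 P3 P4] [Q1 Q2 Q3 Q4]|_ [u + <-]].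
    have t1' : 0 <= 1 - t by rewrite subr_ge0.
    have mix (z : R) : z = t * z + (1 - t) * z by ring.
    split.
    - by rewrite /= [leLHS](mix (px p)) lerD// ler_wpM2l.
    - by rewrite /= [leRHS](mix (px q)) lerD// ler_wpM2l.
    - by rewrite det3_comb addr_ge0// mulr_ge0.
    - move=> u.
      have -> : tang u (comb t P Q) = t * tang u P + (1 - t) * tang u Q.
        by rewrite /tang /comb/=; ring.
      by rewrite -oppr_ge0 opprD -!mulrN addr_ge0// mulr_ge0// oppr_ge0.
  rewrite /= in_itv/= => /andP[pu uq]; split.
  - exact: curveX_le.
  - exact: curveX_le.
  - exact: det3_arc_ge0.
  - by move=> v; exact: tang_arc_le0.
have [u [pu uq xu]] := curveX_surj (ltW pq) px_x x_qx.
have hp : arc p q (pt p) by exists p; rewrite //= bound_itvE ltW.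
have hq : arc p q (pt q) by exists q; rewrite //= bound_itvE ltW.
have hu : arc p q (pt u) by exists u; rewrite //= in_itv/= pu.
have hc : convex_hull (arc p q) (x, chord p q x).
  pose t := (x - px p) / (px q - px p).
  have -> : (x, chord p q x) = comb t (pt q) (pt p).
    rewrite /comb /pt /chord /t/=; congr pair; field; rewrite gt_eqF//.
  apply: convex_hull_comb; [|exact: sub_convex_hull..].
  by rewrite /t divr_ge0 ?subr_ge0 ?(ltW dpx)//= ler_pdivrMr// mul1r lerD2r.
have cg := chord_le_graph pq px_x x_qx.
pose t := (y - chord p q x) / (graph x - chord p q x).
have -> : (x, y) = comb t (pt u) (x, chord p q x).
  have e : t * (graph x - chord p q x) = y - chord p q x.
    rewrite /t; have [g0|g0] := eqVneq (graph x - chord p q x) 0; last by rewrite divfK.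
    rewrite g0 mulr0; apply/esym/eqP; rewrite subr_eq0 eq_le cy andbT.
    by move/eqP: g0; rewrite subr_eq0 => /eqP <-.
  rewrite /comb/= -xu -graph_curveX -xu; congr pair; first by ring.
  by rewrite [LHS](_ : _ = y - chord p q x + chord p q x); [rewrite -e; ring|rewrite subrK].
apply: convex_hull_comb; [|exact: sub_convex_hull|exact: hc].
rewrite /t divr_ge0 ?subr_ge0//=; have [->|g0] := eqVneq (graph x - chord p q x) 0.
  by rewrite invr0 mulr0.
by rewrite ler_pdivrMr ?mul1r ?lerD2r// lt_neqAle eq_sym g0 subr_ge0.
Qed.

Lemma is_derive_curveX u : is_derive u 1 px (A * cs k u).
Proof.
have ? := is_derive_sn k u.
by rewrite /curveX; apply: is_derive_eq; rewrite /GRing.scale/=; ring.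
Qed.

Lemma continuous_cs : continuous (cs k).
Proof.
move=> u; apply: differentiable_continuous; apply/derivable1_diffP.
by have [] := is_derive_cs k u.
Qed.

(** The substitution x = curveX u turns the height between the chord and the
graph into a combination of the functions sn, vs, ms, with the primitive
(sn vs - ms) / 2 of vs cs. *)
Lemma area_hull_arc p q : p < q ->
  area (convex_hull (arc p q)) = (A * B * (ms k (q - p) / 2))%:E.
Proof.
move=> pq; have dpx := curveX_incr k x0 A0 pq.
have dpx0 : px q - px p != 0 by rewrite gt_eqF ?subr_gt0.
rewrite (@area_between _ _ (chord p q) graph (px p) (px q)); first last.
- by move=> x y; exact: convex_hull_arc.
- by move=> x h1 h2; exact: chord_le_graph.
have cG : continuous (fun x => graph x - chord p q x).
  move=> x; apply: cvgB.
    apply: (@continuous_comp _ _ _ (fun x => asn k ((x - x0) / A)) py).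
      apply: (@continuous_comp _ _ _ (fun x => (x - x0) / A) (asn k)).
        by apply: cvgMl; apply: cvgB; [exact: cvg_id|exact: cvg_cst].
      exact: continuous_asn.
    exact: continuous_curveY.
  apply: cvgD; first exact: cvg_cst.
  by apply: cvgMr; apply: cvgB; [exact: cvg_id|exact: cvg_cst].
have dE : derive1 px = fun u => A * cs k u.
  by apply/funext => u; rewrite derive1E; have [_ ->] := is_derive_curveX u.
have cd : continuous (derive1 px).
  by rewrite dE => u; apply: cvgMr; exact: continuous_cs.
have cpx : continuous px by exact: continuous_curveX.
rewrite (@integration_by_substitution_increasing _ px _ p q); first last.
- exact: continuous_subspaceT.
- split.
  + by move=> u _; have [] := is_derive_curveX u.
  + exact/cvg_at_right_filter/cpx.
  + exact/cvg_at_left_filter/cpx.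
- by apply/cvg_ex; exists (derive1 px q); exact/cvg_at_left_filter/cd.
- by apply/cvg_ex; exists (derive1 px p); exact/cvg_at_right_filter/cd.
- by move=> u _; exact: cd.
- by move=> u v _ _; exact: curveX_incr.
- exact: ltW.
pose F u := A * (y0 * sn k u - B * ((sn k u * vs k u - ms k u) / 2))
  - py p * px u - (py q - py p) / (px q - px p) * ((px u - px p) ^+ 2 / 2).
pose f := ((fun x => graph x - chord p q x) \o px) * derive1 px.
have dF (u : R) : is_derive u 1 F (f u).
  rewrite /f !fctE dE /= graph_curveX /chord.
  have ? := is_derive_curveX u; have ? := is_derive_sn k u.
  have ? := is_derive_vs k u; have ? := is_derive_ms k u.
  apply: is_derive_eq; rewrite /GRing.scale/=.
  have h := sn_sq k u; rewrite [in py u]/curveY.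
  by field: h.
have cf : continuous f.
  move=> u; apply: cvgM; last exact: cd.
  exact: (continuous_comp (@cpx u) (@cG (px u))).
rewrite (integral_derivative (ltW pq) dF cf); congr EFin.
rewrite msB /F subrr expr0n/= mul0r mulr0 subr0.
(* The slope of the chord is cleared before its denominator is unfolded. *)
rewrite (_ : (py q - py p) / (px q - px p) * ((px q - px p) ^+ 2 / 2) =
  (py q - py p) * (px q - px p) / 2); last by field.
by rewrite /curveX /curveY; field.
Qed.

(** On the tangent at p, at distance vs(d) / sn(d) counted in units of the
velocity vector; the next lemma shows that it is on the tangent at p + d too,
at the same distance before the contact point. *)
Definition apex p d : R * R :=
  (px p + vs k d / sn k d * (A * cs k p), py p - vs k d / sn k d * (B * sn k p)).

Lemma apexE p d : 0 < d -> apex p d =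
  (px (p + d) - vs k d / sn k d * (A * cs k (p + d)),
   py (p + d) + vs k d / sn k d * (B * sn k (p + d))).
Proof.
move=> d0; have s0 : sn k d != 0 by rewrite gt_eqF// sn_gt0.
have h1 : cs k (p + d) = cs k p + k ^+ 2 * (sn k p * sn k d + cs k p * vs k d).
  by rewrite [LHS]csE vsD; have h := csE k p; ring: h.
have ht : vs k d / sn k d * sn k d = vs k d by rewrite divfK.
have h5 : vs k d / sn k d * (k ^+ 2 * vs k d) = sn k d - 2 * (vs k d / sn k d).
  have -> : k ^+ 2 * vs k d = cs k d - 1 by rewrite csE; ring.
  have -> : cs k d - 1 = sn k d ^+ 2 / vs k d - 2.
    by rewrite sn_sq; field; rewrite gt_eqF// vs_gt0.
  by field; rewrite s0 gt_eqF// vs_gt0.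
rewrite /apex h1 /curveX /curveY snD vsD.
move: (vs k d / sn k d) ht h5 => t ht h5.
congr pair; apply/eqP; rewrite -subr_eq0; apply/eqP.
  transitivity (A * k ^+ 2 * sn k p * (t * sn k d - vs k d) +
    A * cs k p * (t * (k ^+ 2 * vs k d) - (sn k d - 2 * t))); first by ring.
  by rewrite ht h5 !subrr !mulr0 addr0.
transitivity (- (B * cs k p * (t * sn k d - vs k d) +
  B * sn k p * (t * (k ^+ 2 * vs k d) - (sn k d - 2 * t)))); first by ring.
by rewrite ht h5 !subrr !mulr0 addr0 oppr0.
Qed.

Definition tangent_triangle p q := triangle (pt p) (pt q) (apex p (q - p)).

Lemma det3_apex p q : p < q -> det3 (pt p) (pt q) (apex p (q - p)) =
  A * B * (vs k (q - p) ^+ 2 / sn k (q - p)).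
Proof.
move=> pq; have := tang_arc p (q - p); rewrite subrKC /tang => h.
transitivity (- (vs k (q - p) / sn k (q - p) *
    (A * cs k p * ((pt q).2 - py p) + B * sn k p * ((pt q).1 - px p)))).
  by rewrite /det3 /apex /=; ring.
by rewrite h; field; rewrite gt_eqF// sn_gt0// subr_gt0.
Qed.

Lemma det3_apex_gt0 p q : p < q -> 0 < det3 (pt p) (pt q) (apex p (q - p)).
Proof.
move=> pq; rewrite det3_apex//.
by rewrite mulr_gt0 ?divr_gt0 ?exprn_gt0 ?vs_gt0 ?sn_gt0 ?subr_gt0// mulr_gt0.
Qed.

Lemma tau_gt0 p q : p < q -> 0 < vs k (q - p) / sn k (q - p).
Proof. by move=> pq; rewrite divr_gt0 ?vs_gt0 ?sn_gt0 ?subr_gt0. Qed.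

Lemma area_tangent_triangle p q : p < q ->
  area (tangent_triangle p q) =
  (A * B * (vs k (q - p) ^+ 2 / (2 * sn k (q - p))))%:E.
Proof.
move=> pq; have t0 := tau_gt0 pq.
rewrite area_triangle ?det3_apex_gt0// ?det3_apex//; last first.
- by rewrite apexE ?subr_gt0// subrKC/= ltrBlDr ltrDl mulr_gt0// mulr_gt0 ?cs_gt0.
- by rewrite ltrDl mulr_gt0// mulr_gt0 ?cs_gt0.
by congr EFin; field; rewrite gt_eqF// sn_gt0 ?subr_gt0.
Qed.

(** The arc is on the inner side of both tangents and of the chord. *)
Lemma tangent_triangle_covering p q : p < q ->
  covering_triangle (arc p q) (tangent_triangle p q).
Proof.
move=> pq; have D0 := det3_apex_gt0 pq; have t0 := tau_gt0 pq.
exists (pt p), (pt q), (apex p (q - p)); split=> //.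
- by move/collinearE => D; rewrite D ltxx in D0.
- exact: arc_extremities.
rewrite /tangent_triangle triangle_sides ?gt_eqF// => _ [u + <-].
rewrite /= in_itv/= => /andP[pu uq]; split; rewrite pmulr_rge0//.
- rewrite (_ : det3 _ _ _ = - (vs k (q - p) / sn k (q - p) * tang q (pt u))).
    by rewrite oppr_ge0 pmulr_rle0// tang_arc_le0.
  rewrite apexE ?subr_gt0// subrKC /det3 /tang /=; ring.
- rewrite (_ : det3 _ _ _ = - (vs k (q - p) / sn k (q - p) * tang p (pt u))).
    by rewrite oppr_ge0 pmulr_rle0// tang_arc_le0.
  rewrite /apex /det3 /tang /=; ring.
- exact: det3_arc_ge0.
Qed.

(** Only the apex has to be located. It is above the chord like c; and the side
from the end p to c leaves the arc on its inner side, hence also the tangent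
direction at p by [first_order_ge0], and so the apex. The same holds at q. *)
Lemma tangent_triangle_least_oriented p q c : p < q ->
  det3 (pt p) (pt q) c != 0 ->
  arc p q `<=` triangle (pt p) (pt q) c ->
  tangent_triangle p q `<=` triangle (pt p) (pt q) c.
Proof.
move=> pq D0 sub; have t0 := tau_gt0 pq.
have dqp : 0 < q - p by rewrite subr_gt0.
have inside u : p <= u -> u <= q -> sides (pt p) (pt q) c (pt u).
  by move=> pu uq; rewrite -triangle_sides//; apply: sub; exists u; rewrite //= in_itv/= pu.
have Dp : 0 < det3 (pt p) (pt q) c.
  (* An interior point of the arc shows that c is above the chord. *)
  have [pm mq] : p < (p + q) / 2 /\ (p + q) / 2 < q by rewrite !midf_lt.
  have [_ _] := inside _ (ltW pm) (ltW mq).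
  by rewrite pmulr_lge0 ?det3_arc_gt0// lt_neqAle eq_sym D0.
apply: triangle_sub.
- by apply: sub_convex_hull; left; left.
- by apply: sub_convex_hull; left; right.
rewrite triangle_sides//; split.
- rewrite pmulr_rge0//.
  have al : 0 <= tang q c.
    apply: (@first_order_ge0 R k (q - p) _
      (- (c.1 - px q) * (B * cs k q) - (c.2 - py q) * (A * k ^+ 2 * sn k q))) => // e e0 ed.
    have [||+ _ _] := inside (q - e).
    - by rewrite lerBrDl -lerBrDr.
    - by rewrite gerBl ltW.
    rewrite pmulr_rge0// /det3 /pt/= curveX_taylor curveY_taylor snN vsN.
    by congr (_ <= _); rewrite /tang; ring.
  rewrite (_ : det3 _ _ _ = vs k (q - p) / sn k (q - p) * tang q c).
    by rewrite mulr_ge0// ltW.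
  by rewrite apexE// subrKC /det3 /tang/=; ring.
- rewrite pmulr_rge0//.
  have al : 0 <= tang p c.
    apply: (@first_order_ge0 R k (q - p) _
      ((c.1 - px p) * (B * cs k p) + (c.2 - py p) * (A * k ^+ 2 * sn k p))) => // e e0 ed.
    have [||_ + _] := inside (p + e).
    - by rewrite lerDl ltW.
    - by rewrite -lerBrDl.
    rewrite pmulr_rge0// (_ : det3 _ _ _ = (px p - c.1) * (py (p + e) - py p)
      - (py p - c.2) * (px (p + e) - px p)); last by rewrite /det3/=; ring.
    by rewrite curveX_taylor curveY_taylor; congr (_ <= _); rewrite /tang; ring.
  rewrite (_ : det3 _ _ _ = vs k (q - p) / sn k (q - p) * tang p c).
    by rewrite mulr_ge0// ltW.
  by rewrite /apex /det3 /tang/=; ring.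
- by rewrite pmulr_rge0// ltW// det3_apex_gt0.
Qed.

Lemma tangent_triangle_least p q T : p < q -> covering_triangle (arc p q) T ->
  tangent_triangle p q `<=` T.
Proof.
move=> pq [a [b [c [ncol -> ext sub]]]].
have D0 : det3 a b c != 0 by apply/eqP => /collinearE.
have [[ea eb]|[ea eb]] := extremities_arc A0 pq ext; move: D0 sub; rewrite ea eb.
  exact: tangent_triangle_least_oriented.
rewrite triangle_swap => D0; apply: tangent_triangle_least_oriented => //.
by apply: contra_neq D0; rewrite /det3 => h; rewrite -[LHS]opprK -[RHS]oppr0 -h; congr (- _); ring.
Qed.

Lemma enveloping_triangleE p q T : p < q -> enveloping_triangle (arc p q) T ->
  T = tangent_triangle p q.
Proof.
move=> pq [covT TE]; apply/seteqP; split; last exact: tangent_triangle_least.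
by rewrite TE; apply: bigcap_inf; exact: tangent_triangle_covering.
Qed.

End hull_and_triangle.

(** * Affine length *)

Section affine_length.
Context {R : realType}.
Variables (k A B x0 y0 : R).
Hypotheses (A0 : 0 < A) (B0 : 0 < B).
Local Notation px := (curveX k A x0).
Local Notation py := (curveY k B y0).
Local Notation pt := (curvePt k A B x0 y0).
Local Notation arc := (curveArc k A B x0 y0).
Local Notation mu := (@lebesgue_measure R).
Implicit Types (p q u t : R).

Lemma derive1_funE (f df : R -> R) :
  (forall x : R, is_derive x 1 f (df x)) -> derive1 f = df.
Proof. by move=> fdf; apply/funext => x; rewrite derive1E; have [_ ->] := fdf x. Qed.

Lemma is_derive_lin (a b t : R) (f u h v : R -> R) (df du dh dv : R) :
  is_derive t 1 f df -> is_derive t 1 u du ->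
  is_derive t 1 h dh -> is_derive t 1 v dv ->
  is_derive t 1 (fun s => a * (f s * u s) + b * (h s * v s))
    (a * (f t * du + df * u t) + b * (h t * dv + dh * v t)).
Proof. by move=> *; apply: is_derive_eq; rewrite /GRing.scale/=; ring. Qed.

Lemma cube_rootK (a : R) : 0 <= a -> (a ^+ 3) `^ 3^-1 = a.
Proof.
by move=> a0; rewrite -powR_mulrn// -powRrM divff// powRr1.
Qed.

Lemma powR3K (a : R) : 0 <= a -> (a `^ 3^-1) ^+ 3 = a.
Proof.
by move=> a0; rewrite -powR_mulrn ?powR_ge0// -powRrM mulVf// powRr1.
Qed.

(** The speed cancels out: the integrand of the affine length depends only on
the determinant of the first two derivatives. *)
Lemma affine_integrand (s D J v : R) : 0 < s -> 0 <= J -> 0 <= v ->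
  D = J * v ^+ 3 -> (D / s ^+ 3) `^ 3^-1 * s = J `^ 3^-1 * v.
Proof.
move=> s0 J0 v0 ->.
have -> : J * v ^+ 3 / s ^+ 3 = J * (v / s) ^+ 3 by field; rewrite gt_eqF.
rewrite powRM// ?exprn_ge0 ?divr_ge0 ?(ltW s0)// cube_rootK ?divr_ge0 ?(ltW s0)//.
by rewrite -mulrA divfK// gt_eqF.
Qed.

Section regular.
Variables (p q : R) (g : R -> R * R).
Hypotheses (pq : p < q) (gr : regular_param g (arc p q)).
Let x : R -> R := fst \o g.
Let y : R -> R := snd \o g.
Let phi t := asn k ((x t - x0) / A).
Let dphi t := (cs k (phi t))^-1 * (A^-1 * derive1 x t).

Let gs : simple_param g (arc p q). Proof. by case: gr. Qed.

Let sub : arc p q `<=` range pt.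
Proof. by move=> _ [u _ <-]; exists u. Qed.

Let is_derive_x (t : R) : is_derive t 1 x (derive1 x t).
Proof.
by case: gr => _ /(_ t)[+ _] _ _ _; rewrite derive1E; exact: derivableP.
Qed.

Let is_derive_dx (t : R) : is_derive t 1 (derive1 x) (derive1n 2 x t).
Proof.
by case: gr => _ _ /(_ t)[+ _] _ _; rewrite derive1nS derive1n1;
  rewrite [X in is_derive _ _ _ X]derive1E; exact: derivableP.
Qed.

Let is_derive_dy (t : R) : is_derive t 1 (derive1 y) (derive1n 2 y t).
Proof.
by case: gr => _ _ /(_ t)[_ +] _ _; rewrite derive1nS derive1n1;
  rewrite [X in is_derive _ _ _ X]derive1E; exact: derivableP.
Qed.

Let is_derive_phi (t : R) : is_derive t 1 phi (dphi t).
Proof.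
have ? := is_derive_x t; have ? := is_derive_asn k (A^-1 * (x t - x0)).
rewrite (_ : phi = asn k \o (fun t => A^-1 * (x t - x0))); last first.
  by apply/funext => s; rewrite /phi /= mulrC.
apply: is_derive_eq; rewrite /dphi /phi /= /GRing.scale/= (mulrC _ A^-1). ring.
Qed.

Let continuous_phi : continuous phi.
Proof.
move=> t; apply: differentiable_continuous; apply/derivable1_diffP.
by have [] := is_derive_phi t.
Qed.

Let continuous_dphi : continuous dphi.
Proof.
move=> t; apply: cvgM.
  apply: cvgV; first by rewrite gt_eqF// cs_gt0.
  exact: (continuous_comp (@continuous_phi t) (@continuous_cs R k (phi t))).
apply: cvgMr; apply: differentiable_continuous; apply/derivable1_diffP.
by have [] := is_derive_dx t.
Qed.

Let xE t : x t = px (phi t).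
Proof. by rewrite /curveX asnK mulrC divfK ?subrKC// gt_eqF. Qed.

Let yE t : t \in `[0, 1] -> y t = py (phi t).
Proof. by move=> t01; rewrite /y /= (param_coord A0 gs sub t01). Qed.

Let dxE t : derive1 x t = A * cs k (phi t) * dphi t.
Proof. by rewrite /dphi; field; rewrite !gt_eqF// cs_gt0. Qed.

Let near_01 (P : R -> Prop) t : t \in `]0, 1[ ->
  (forall s, s \in `]0, 1[ -> P s) -> \near t, P t.
Proof. by move=> t01 Ps; near=> s; apply: Ps; near: s; exact: near_in_itvoo.
Unshelve. all: by end_near. Qed.

Let dyE t : t \in `]0, 1[ -> derive1 y t = - (B * sn k (phi t) * dphi t).
Proof.
move=> t01.
have ? := is_derive_phi t; have ? := is_derive_vs k (phi t).
have D : is_derive t 1 (fun s => y0 - B * vs k (phi s)) (- (B * sn k (phi t) * dphi t)).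
  by apply: is_derive_eq; rewrite /GRing.scale/=; ring.
have : is_derive t 1 y (- (B * sn k (phi t) * dphi t)).
  apply: near_eq_is_derive D; apply: near_01 => // s s01.
  by rewrite yE//; exact: subset_itv_oo_cc.
by rewrite derive1E => -[_ ->].
Qed.

(** On ]0, 1[ the curve satisfies A cs(phi) y' + B sn(phi) x' = 0. Differentiating
this relation once gives the determinant without the second derivative of
phi. *)
Let det_second_order t : t \in `]0, 1[ ->
  derive1 x t * derive1n 2 y t - derive1 y t * derive1n 2 x t =
  - (A * B * dphi t ^+ 3).
Proof.
move=> t01.
have ? := is_derive_phi t; have ? := is_derive_cs k (phi t).
have ? := is_derive_sn k (phi t).
have D : is_derive t 1
    (fun s => A * (cs k (phi s) * derive1 y s) + B * (sn k (phi s) * derive1 x s))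
    (A * (cs k (phi t) * derive1n 2 y t + k ^+ 2 * sn k (phi t) * dphi t * derive1 y t)
     + B * (sn k (phi t) * derive1n 2 x t + cs k (phi t) * dphi t * derive1 x t)).
  exact: is_derive_lin (is_derive1_comp _ _) (is_derive_dy t)
    (is_derive1_comp _ _) (is_derive_dx t).
have D0 : is_derive t 1
    (fun s => A * (cs k (phi s) * derive1 y s) + B * (sn k (phi s) * derive1 x s)) 0.
  apply: (near_eq_is_derive _ (is_derive_cst (0 : R) (t : R) 1)).
  by apply: near_01 => // s s01; rewrite dxE dyE// /cst; ring.
have [_ e1] := D; have [_ e0] := D0; have e2 := etrans (esym e1) e0.
have := cs_sq k (phi t) => h; rewrite dxE dyE//; rewrite dxE dyE// in e2.
rewrite -[derive1n 2 y t]/(derive1 (derive1 y) t).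
rewrite -[derive1n 2 x t]/(derive1 (derive1 x) t).
(* The factor phi' turns cs(phi) y'' and sn(phi) x'' into terms of the
   determinant, by the formulas for x' and y'. *)
have e3 := congr1 (fun z => dphi t * z) e2; rewrite /= mulr0 in e3.
apply/eqP; rewrite -subr_eq0; apply/eqP; rewrite -e3.
move: (derive1 (derive1 y) t) (derive1 (derive1 x) t) => ddy ddx.
by ring: h.
Qed.

Let speed_gt0 t : t \in `[0, 1] -> 0 < speed g t.
Proof.
case: gr => _ _ _ _ /(_ t) nz /nz; rewrite xpair_eqE negb_and => nz'.
rewrite sqrtr_gt0 lt_neqAle eq_sym paddr_eq0 ?sqr_ge0// !sqrf_eq0 negb_and nz'.
by rewrite addr_ge0 ?sqr_ge0.
Qed.

Let integrandE t : t \in `]0, 1[ ->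
  curvature g t `^ 3^-1 * speed g t = (A * B) `^ 3^-1 * `|dphi t|.
Proof.
move=> t01; apply: affine_integrand => //.
- by apply: speed_gt0; exact: subset_itv_oo_cc.
- by rewrite mulr_ge0 ?ltW.
by rewrite det_second_order// normrN normrM normrX gtr0_norm ?mulr_gt0.
Qed.

(** The sign of phi' is constant, as phi is monotone; so the integral of |phi'|
is the length of the parameter interval, by the fundamental theorem. The
integrand is computed on ]0, 1[ only, since at 0 and 1 the relation between x
and y holds on one side; these two points have measure zero. *)
Lemma regular_param_affine_length :
  \int[mu]_(t in `[0, 1]) (curvature g t `^ 3^-1 * speed g t) =
  (A * B) `^ 3^-1 * (q - p).
Proof.
have phiE : phi = coord k A x0 \o g by [].
have pc : {within `[0, 1], continuous phi} by exact: param_coord_cont gs.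
have pi := param_coord_inj A0 gs sub; rewrite -phiE in pi.
have := param_arc A0 gs sub; have := param_coord_neq A0 gs sub.
rewrite -phiE => pn pa.
have ab : Num.min (phi 0) (phi 1) <= Num.max (phi 0) (phi 1).
  by rewrite ge_min le_max lexx.
have [pE qE] := arc_inj A0 (ltW pq) ab pa.
have [eps [epsE sgn]] : exists eps : R, eps * (phi 1 - phi 0) = q - p /\
    forall t, t \in `]0, 1[ -> `|dphi t| = eps * dphi t.
  have dphiE := derive1_funE is_derive_phi.
  have dd : {in (`]0, 1[%classic : set R), forall t : R, derivable phi t 1}.
    by move=> t _; have [] := is_derive_phi t.
  have [lt01|lt10|e] := ltgtP (phi 0) (phi 1); last by rewrite e eqxx in pn.
    exists 1; split; first by rewrite pE qE min_l ?max_r ?ltW// mul1r.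
    move=> t t01; rewrite mul1r ger0_norm// -dphiE.
    apply: (@incr_derive1_ge0_itv _ _ true false 0 1) => // s r s01 r01 sr.
    by rewrite (leW_mono_in (segment_continuous_inj_le (ltW lt01) pc pi)).
  exists (-1); split; first by rewrite pE qE min_r ?max_l ?ltW// mulN1r opprB.
  move=> t t01; rewrite mulN1r ler0_norm// -dphiE.
  apply: (@decr_derive1_le0_itv _ _ true false 0 1) => // s r s01 r01 sr.
  by rewrite (leW_nmono_in (segment_continuous_inj_ge (ltW lt10) pc pi)).
pose F t := (A * B) `^ 3^-1 * eps * phi t.
pose f t := (A * B) `^ 3^-1 * eps * dphi t.
have cf : continuous f by move=> t; apply: cvgMr; exact: continuous_dphi.
have dF (t : R) : is_derive t 1 F (f t).
  by have ? := is_derive_phi t; exact: is_deriveZ.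
have fE : {in `]0, 1[, f =1 (fun t => curvature g t `^ 3^-1 * speed g t)}.
  by move=> t t01; rewrite integrandE// sgn// mulrA.
have mf : measurable_fun (`]0, 1[%classic : set R) f.
  by apply: measurable_funTS; exact: continuous_measurable_fun.
rewrite /Rintegral -(@eq_integral_itv_bounded _ 0 1 _ f)//; last first.
  by apply: eq_measurable_fun mf => t; rewrite inE; exact: fE.
rewrite (integral_derivative ler01 dF cf) /= /F -mulrBr.
by rewrite -mulrA epsE.
Qed.

End regular.

Lemma arc_regular_param p q : p < q ->
  exists g : R -> R * R, regular_param g (arc p q).
Proof.
move=> pq; pose l t := p + t * (q - p).
have dl (t : R) : is_derive t 1 l (q - p).
  by apply: is_derive_eq; rewrite /GRing.scale/=; ring.
have cl : continuous l.
  by move=> t; apply: cvgD; [exact: cvg_cst|apply: cvgMl; exact: cvg_id].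
pose x t := px (l t); pose y t := py (l t).
pose dx t := A * cs k (l t) * (q - p).
pose dy t := - (B * sn k (l t) * (q - p)).
pose ddx t := A * (k ^+ 2 * sn k (l t)) * (q - p) ^+ 2.
pose ddy t := - (B * cs k (l t) * (q - p) ^+ 2).
have Dx (t : R) : is_derive t 1 x (dx t).
  have ? := is_derive_sn k (l t).
  by rewrite /x /curveX; apply: is_derive_eq; rewrite /GRing.scale/= /dx; ring.
have Dy (t : R) : is_derive t 1 y (dy t).
  have ? := is_derive_vs k (l t).
  by rewrite /y /curveY; apply: is_derive_eq; rewrite /GRing.scale/= /dy; ring.
have DDx (t : R) : is_derive t 1 dx (ddx t).
  have ? := is_derive_cs k (l t).
  by rewrite /dx; apply: is_derive_eq; rewrite /GRing.scale/= /ddx; ring.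
have DDy (t : R) : is_derive t 1 dy (ddy t).
  have ? := is_derive_sn k (l t).
  by rewrite /dy; apply: is_derive_eq; rewrite /GRing.scale/= /ddy; ring.
have xE : derive1 x = dx := derive1_funE Dx.
have yE : derive1 y = dy := derive1_funE Dy.
have dxE : derive1 dx = ddx := derive1_funE DDx.
have dyE : derive1 dy = ddy := derive1_funE DDy.
have csl : continuous (fun t => cs k (l t)).
  by move=> t; exact: (continuous_comp (@cl t) (@continuous_cs R k (l t))).
have snl : continuous (fun t => sn k (l t)).
  by move=> t; exact: (continuous_comp (@cl t) (@continuous_sn R k (l t))).
exists (pt \o l); rewrite /regular_param -/x -/y.
rewrite [fst \o _](_ : _ = x)// [snd \o _](_ : _ = y)//.
rewrite !derive1nS !derive1n0 xE yE dxE dyE; split.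
- exact: linear_param.
- by move=> t; split; [case: (Dx t)|case: (Dy t)].
- by move=> t; split; [case: (DDx t)|case: (DDy t)].
- split=> t; first by apply: cvgMl; apply: cvgMr; apply: cvgMr; exact: snl.
  by apply: cvgN; apply: cvgMl; apply: cvgMr; exact: csl.
- move=> t _; rewrite xpair_eqE negb_and /dx.
  by rewrite gt_eqF// mulr_gt0 ?subr_gt0// mulr_gt0 ?cs_gt0.
Qed.

Lemma affine_length_arc p q : p < q ->
  affine_length (arc p q) = (A * B) `^ 3^-1 * (q - p).
Proof.
move=> pq; rewrite /affine_length; case: xgetP => [l _ [g gr ->]|none].
  exact: regular_param_affine_length.
have [g gr] := arc_regular_param pq.
by case: (none (\int[mu]_(t in `[0, 1]) (curvature g t `^ 3^-1 * speed g t))); exists g.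
Qed.

End affine_length.

(** * Invariants of subarcs of the curves H *)

Section invariants.
Context {R : realType}.
Implicit Types (k l d e al : R) (C T : set (R * R)).

(** The Jacobian of the affine map from the conic (sn, vs) to H. *)
Definition jac k : R := cs k 1 / sn k 1 ^+ 3.

(** The curve H written on the conic with parameter k: the abscissa sn k u is
normalized to 1 at u = 1, and u = 1 - 2 t in terms of the parameter t of H. *)
Definition harc k : set (R * R) :=
  let A := (sn k 1)^-1 in let B := cs k 1 / sn k 1 ^+ 2 in
  curveArc k A B 1 (B * vs k 1) (-1) 1.

Lemma jac_gt0 k : 0 < jac k.
Proof. by rewrite divr_gt0 ?cs_gt0 ?exprn_gt0 ?sn_gt0. Qed.

Lemma simple_curve_not_singleton C (P : R * R) : simple_curve C -> C `<=` [set P] -> False.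
Proof.
move=> [g [_ gi gE]] CP.
have i0 : (0 : R) \in `[0, 1] by rewrite bound_itvE.
have i1 : (1 : R) \in `[0, 1] by rewrite bound_itvE.
have h t : t \in `[0, 1] -> g t = P by move=> ti; apply: CP; rewrite -gE; exists t.
by have /eqP := gi _ _ i0 i1 (etrans (h _ i0) (esym (h _ i1))); rewrite eq_sym oner_eq0.
Qed.

Lemma Hcurve0 : @Hcurve R 0 = harc 0.
Proof.
rewrite /Hcurve eqxx /harc /curveArc /curvePt /curveX /curveY /cs /sn /vs eqxx.
rewrite mul0r cosh0; apply/seteqP; split=> _ [x /= + <-]; rewrite in_itv/= => /andP[h1 h2].
  exists (x - 1); first by rewrite /= in_itv/=; apply/andP; split; lra.
  by congr pair; field.
exists (x + 1); first by rewrite /= in_itv/=; apply/andP; split; lra.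
by congr pair; field.
Qed.

(** By the identity 2 sinh a sinh b = cosh (a + b) - cosh (a - b), at a = k (1 - t), b = k t. *)
Lemma Hcurve_rpar al : al != 0 -> rpar al != 0 -> Hcurve al = harc (rpar al).
Proof.
move=> al0 k0; rewrite /Hcurve (negbTE al0) /harc /hyperX /hyperY /=.
set k := rpar al in k0 *.
have S0 : sinh k != 0.
  have -> : sinh k = k * sn k 1 by rewrite /sn (negbTE k0) mulr1 mulrC divfK.
  by rewrite mulf_neq0// gt_eqF// sn_gt0.
have E t : (1 + sinh (k * (1 - 2 * t)) / sinh k,
    2 * cosh k / sinh k ^+ 2 * sinh (k * (1 - t)) * sinh (k * t)) =
  curvePt k (sn k 1)^-1 (cs k 1 / sn k 1 ^+ 2) 1
    (cs k 1 / sn k 1 ^+ 2 * vs k 1) (1 - 2 * t).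
  rewrite /curvePt /curveX /curveY /cs /sn /vs (negbTE k0) !mulr1.
  congr pair; first by field; rewrite k0 S0.
  have e1 : k = k * (1 - t) + k * t by ring.
  have e2 : k * (1 - 2 * t) = k * (1 - t) + - (k * t) by ring.
  have e3 : cosh k - cosh (k * (1 - 2 * t)) = 2 * sinh (k * (1 - t)) * sinh (k * t).
    by rewrite [in cosh k]e1 e2 !coshD sinhN coshN; ring.
  transitivity (cosh k / sinh k ^+ 2 * (2 * sinh (k * (1 - t)) * sinh (k * t))).
    by ring.
  by rewrite -e3; field; rewrite k0 S0.
apply/seteqP; split=> _ [t /= + <-]; rewrite in_itv/= => /andP[h1 h2].
  by rewrite E; exists (1 - 2 * t); rewrite //= in_itv/=; apply/andP; split; lra.
exists ((1 - t) / 2); first by rewrite /= in_itv/=; apply/andP; split; lra.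
by rewrite E; congr curvePt; field.
Qed.

(** The presence of a simple curve C excludes a parameter rpar al equal to its
default value 0 for al > 0, since H would then be a single point. *)
Lemma Hcurve_harc al C : 0 <= al -> simple_curve C -> C `<=` Hcurve al ->
  exists k, [/\ 0 <= k, Psi k = al & Hcurve al = harc k].
Proof.
move=> al0 Cs CH; have [->|aln] := eqVneq al 0.
  by exists 0; split; rewrite ?Hcurve0// /Psi eqxx.
have [k0|k0] := eqVneq (rpar al) 0.
  exfalso; apply: (@simple_curve_not_singleton C (1, 0)) => //.
  apply: (subset_trans CH); rewrite /Hcurve (negbTE aln) => _ [t _ <-] /=.
  by rewrite /hyperX /hyperY k0 !mul0r sinh0 !mulr0 mul0r addr0.
exists (rpar al); rewrite Hcurve_rpar//; split=> //; move: k0; rewrite /rpar.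
  by case: xgetP => [k _ []//|_]; rewrite eqxx.
by case: xgetP => [k _ []//|_]; rewrite eqxx.
Qed.

Lemma curve_invariants k C T : simple_curve C -> C `<=` harc k ->
  enveloping_triangle C T ->
  exists d, [/\ 0 < d, area T = (jac k * (d ^+ 3 * tshape (k * d)))%:E,
    area (convex_hull C) = (jac k * (d ^+ 3 * hshape (k * d)))%:E &
    affine_length C = jac k `^ 3^-1 * d].
Proof.
move=> [g gC] CH env.
have s0 : 0 < sn k 1 by rewrite sn_gt0.
have A0 : 0 < (sn k 1)^-1 by rewrite invr_gt0.
have B0 : 0 < cs k 1 / sn k 1 ^+ 2 by rewrite divr_gt0 ?cs_gt0 ?exprn_gt0.
move: CH; rewrite /harc; set A := _^-1 in A0 *; set B := _ / _ in B0 *.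
set y0 := B * _ => CH.
have sub : C `<=` range (curvePt k A B 1 y0).
  by move=> P /CH [u _ <-]; exists u.
have JE : A * B = jac k by rewrite /jac /A /B; field; rewrite gt_eqF.
have := param_arc A0 gC sub; have := param_coord_neq A0 gC sub.
set a := _ 0; set b := _ 1 => ab CE.
have pq : Num.min a b < Num.max a b by rewrite lt_max !gt_min !ltxx/= orbF orbC -neq_lt.
move: (Num.min a b) (Num.max a b) pq CE => p q pq CE; rewrite {}CE in env *.
exists (q - p); have d0 : 0 < q - p by rewrite subr_gt0.
have dn0 : q - p != 0 by rewrite gt_eqF.
rewrite (enveloping_triangleE A0 B0 pq env) area_tangent_triangle//.
rewrite area_hull_arc// affine_length_arc// JE.
by rewrite tshapeE// hshapeE.
Qed.

Lemma incr_inj (f : R -> R) (x y : R) :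
  (forall x y, 0 <= x -> x < y -> f x < f y) ->
  0 <= x -> 0 <= y -> f x = f y -> x = y.
Proof.
move=> fi x0 y0 fxy; case: (ltgtP x y) => // h.
  by have := fi _ _ x0 h; rewrite fxy ltxx.
by have := fi _ _ y0 h; rewrite fxy ltxx.
Qed.

(** f increases in the weak sense along k d even when k = 0; the factor d^3
makes the product strictly increasing. *)
Lemma cube_mul_inj (f : R -> R) k d e : 0 <= k -> 0 < d -> 0 < e ->
  (forall x, 0 < f x) -> (forall x y, 0 <= x -> x < y -> f x < f y) ->
  d ^+ 3 * f (k * d) = e ^+ 3 * f (k * e) -> d = e.
Proof.
move=> k0 d0 e0 f0 fi.
have fle x y : 0 <= x -> x <= y -> f x <= f y.
  by move=> x0; rewrite le_eqVlt => /predU1P[->//|/(fi _ _ x0)/ltW].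
have lt a b : 0 < a -> a < b -> a ^+ 3 * f (k * a) < b ^+ 3 * f (k * b).
  move=> a0 ab; apply: (@lt_le_trans _ _ (b ^+ 3 * f (k * a))).
    by rewrite ltr_pM2r// ltrXn2r// ltW.
  rewrite ler_wpM2l ?exprn_ge0 ?(ltW (lt_trans a0 ab))// fle ?ler_wpM2l ?(ltW ab)//.
  by rewrite mulr_ge0// ltW.
move=> E; case: (ltgtP d e) => // h.
  by have := lt _ _ d0 h; rewrite E ltxx.
by have := lt _ _ e0 h; rewrite E ltxx.
Qed.

(** J(k) / k^3 = cosh k / (sinh k)^3, a decreasing function of k. *)
Lemma jac_scaled k : 0 < k -> jac k = k ^+ 3 / (sn 1 k ^+ 3 / cs 1 k).
Proof.
move=> k0; have kn : k != 0 by rewrite gt_eqF.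
have := @sn_scale R 1 k kn; rewrite mul1r => ->.
rewrite /jac /cs mul1r mulr1; field.
by rewrite !gt_eqF// ?sn_gt0// cosh_gt0.
Qed.

(** If k d = 0 then k and l both vanish. Otherwise d and e are eliminated, and
J(k) / k^3 = J(l) / l^3. *)
Lemma jac_inj k l d e : 0 <= k -> 0 <= l -> 0 < d -> 0 < e ->
  k * d = l * e -> jac k * d ^+ 3 = jac l * e ^+ 3 -> k = l.
Proof.
move=> k0 l0 d0 e0 xE.
move: k0; rewrite le_eqVlt => /predU1P[k0|k0].
  move: xE => /esym/eqP; rewrite -k0 mul0r mulf_eq0 (gt_eqF e0) orbF => /eqP ->.
  by [].
move: l0; rewrite le_eqVlt => /predU1P[l0|l0].
  by move: xE => /eqP; rewrite -l0 mul0r mulf_eq0 (gt_eqF d0) (gt_eqF k0).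
have scaled m f : 0 < m ->
    jac m * f ^+ 3 = (m * f) ^+ 3 * (sn 1 m ^+ 3 / cs 1 m)^-1.
  by move=> m0; rewrite jac_scaled// exprMn mulrAC.
rewrite !scaled// xE.
have xn : (l * e) ^+ 3 != 0 by rewrite gt_eqF// exprn_gt0// mulr_gt0.
move=> /(mulfI xn)/invr_inj.
have lt (x y : R) : 0 < x -> x < y -> sn 1 x ^+ 3 / cs 1 x < sn 1 y ^+ 3 / cs 1 y.
  apply: (@ratio_incr _ (fun x => sn 1 x ^+ 3) (cs 1)
    (fun x => 3 * sn 1 x ^+ 2 * cs 1 x) (fun x => 1 ^+ 2 * sn 1 x)) => z.
  - by have ? := is_derive_sn 1 z; apply: is_derive_eq; rewrite /GRing.scale/=; ring.
  - exact: is_derive_cs.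
  - by move=> _; exact: cs_gt0.
  move=> z0; have h := cs_sq 1 z.
  rewrite (_ : _ - _ = sn 1 z ^+ 2 * (3 + 2 * sn 1 z ^+ 2)); last by ring: h.
  by rewrite mulr_gt0 ?addr_gt0 ?mulr_gt0 ?exprn_gt0 ?sn_gt0.
move=> E; case: (ltgtP k l) => // h.
  by have := lt _ _ k0 h; rewrite E ltxx.
by have := lt _ _ l0 h; rewrite E ltxx.
Qed.

Lemma affine_length_cube k l d e : 0 < d -> 0 < e ->
  jac k `^ 3^-1 * d = jac l `^ 3^-1 * e -> jac k * d ^+ 3 = jac l * e ^+ 3.
Proof.
move=> d0 e0 /(congr1 (fun x => x ^+ 3)).
by rewrite !exprMn !powR3K// ltW// jac_gt0.
Qed.

End invariants.

Theorem proposition1p14 (R : realType) :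
  (forall (alpha : R) (C1 C2 T1 T2 : set (R * R)),
    0 <= alpha ->
    simple_curve C1 -> C1 `<=` Hcurve alpha ->
    simple_curve C2 -> C2 `<=` Hcurve alpha ->
    enveloping_triangle C1 T1 -> enveloping_triangle C2 T2 ->
    [/\ area T1 = area T2 ->
          affine_length C1 = affine_length C2 /\
          area (convex_hull C1) = area (convex_hull C2),
        affine_length C1 = affine_length C2 ->
          area (convex_hull C1) = area (convex_hull C2) /\
          area T1 = area T2 &
        area (convex_hull C1) = area (convex_hull C2) ->
          affine_length C1 = affine_length C2 /\
          area T1 = area T2])
  /\
  (forall (alpha alpha' : R) (C C' T T' : set (R * R)),
    0 <= alpha -> 0 <= alpha' ->
    simple_curve C -> C `<=` Hcurve alpha ->
    simple_curve C' -> C' `<=` Hcurve alpha' ->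
    enveloping_triangle C T -> enveloping_triangle C' T' ->
    [/\ area T = area T' /\ area (convex_hull C) = area (convex_hull C') ->
          alpha = alpha',
        area T = area T' /\ affine_length C = affine_length C' ->
          alpha = alpha' &
        area (convex_hull C) = area (convex_hull C') /\
        affine_length C = affine_length C' ->
          alpha = alpha']).
Proof.
split.
  move=> al C1 C2 T1 T2 al0 s1 H1 s2 H2 env1 env2.
  have [k [k0 _ HE]] := Hcurve_harc al0 s1 H1; rewrite HE in H1 H2.
  have [d [d0 -> -> ->]] := curve_invariants s1 H1 env1.
  have [e [e0 -> -> ->]] := curve_invariants s2 H2 env2.
  have J0 := jac_gt0 k; have Jn : jac k != 0 by rewrite gt_eqF.
  split.
  - move=> [/(mulfI Jn) E].
    by rewrite (cube_mul_inj k0 d0 e0 tshape_gt0 tshape_incr E).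
  - move/mulfI => -> //.
    by rewrite gt_eqF// powR_gt0.
  - move=> [/(mulfI Jn) E].
    by rewrite (cube_mul_inj k0 d0 e0 hshape_gt0 hshape_incr E).
move=> al al' C C' T T' al0 al'0 s H s' H' env env'.
have [k [k0 kE HE]] := Hcurve_harc al0 s H; rewrite HE in H.
have [l [l0 lE HE']] := Hcurve_harc al'0 s' H'; rewrite HE' in H'.
rewrite -kE -lE {kE lE HE HE' al al' al0 al'0}.
have [d [d0 -> -> ->]] := curve_invariants s H env.
have [e [e0 -> -> ->]] := curve_invariants s' H' env'.
have x0 : 0 <= k * d by rewrite mulr_ge0// ltW.
have y0 : 0 <= l * e by rewrite mulr_ge0// ltW.
have J0 : 0 < jac k * d ^+ 3 by rewrite mulr_gt0 ?jac_gt0 ?exprn_gt0.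
have Jn : jac k * d ^+ 3 != 0 by rewrite gt_eqF.
have J'0 : 0 < jac l * e ^+ 3 by rewrite mulr_gt0 ?jac_gt0 ?exprn_gt0.
have J'n : jac l * e ^+ 3 != 0 by rewrite gt_eqF.
have tn x : tshape x != 0 :> R by rewrite gt_eqF// tshape_gt0.
have cancel a x : a != 0 -> a * hshape x / (a * tshape x) = hshape x / tshape x :> R.
  by move=> a0; rewrite -mulf_div divff// mul1r.
suff same_shape : k * d = l * e /\ jac k * d ^+ 3 = jac l * e ^+ 3 -> Psi k = Psi l.
  split.
  - move=> [[+] [+]]; rewrite !(mulrA (jac k) (d ^+ 3)) !(mulrA (jac l) (e ^+ 3)) => Et Eh.
    apply: same_shape.
    have xE : k * d = l * e.
      apply: (incr_inj (f := fun x => hshape x / tshape x)) => //.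
        exact: htshape_incr.
      have := congr2 (fun h t => h / t) Eh Et.
      by rewrite /= !cancel.
    by split=> //; move: Et; rewrite xE => /(mulIf (tn _)).
  - move=> [[+] /(affine_length_cube d0 e0) EJ]; rewrite (mulrA (jac k)) (mulrA (jac l)) EJ.
    move=> /(mulfI J'n) /(incr_inj tshape_incr x0 y0) xE.
    by apply: same_shape.
  - move=> [[+] /(affine_length_cube d0 e0) EJ]; rewrite (mulrA (jac k)) (mulrA (jac l)) EJ.
    move=> /(mulfI J'n) /(incr_inj hshape_incr x0 y0) xE.
    by apply: same_shape.
by move=> [xE EJ]; rewrite (jac_inj k0 l0 d0 e0 xE EJ).
Qed.
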